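(* Let $H$ be a self-adjoint operator on $\mathcal{H}$ which is affiliated with the commutant $\mathcal{A}'$. Assume $\Omega$ is in the domain of $|H|^{1/2}$ and $\langle H\rangle_\omega=0$. Let $X=\exp_\phi(H-\alpha(H))$. Then the following hold: 1) The domain of $|H|^{1/2}$ is a subspace of the domain of $X^{1/2}$. 2) Any $\psi$ in the domain of $|H|^{1/2}$ satisfies $\|X^{1/2}\psi\|^2\le \|\psi\|^2+\|\,|H|^{1/2}\psi\|^2$. 3) $X^{1/2}\Omega$ is separating for $\mathcal{A}$. 4) If $\mathcal{A}\Omega$ is a core of $|H|^{1/2}$ then $\mathcal{A}\Omega$ is a core of $X^{1/2}$ as well. 5) If $\mathcal{A}\Omega$ is a core of $X^{1/2}$ then $X^{1/2}\Omega$ is cyclic for $\mathcal{A}$.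
   Context: Standing setting: $\mathcal{A}$ is a von Neumann algebra of operators on a Hilbert space $\mathcal{H}$, with commutant $\mathcal{A}'$; $\omega$ is a fixed faithful normal state on $\mathcal{A}$, represented by a unit vector $\Omega\in\mathcal{H}$, $\omega(A)=(A\Omega,\Omega)$, such that the identity representation of $\mathcal{A}$ on $\mathcal{H}$ with vector $\Omega$ is the GNS representation of $\omega$; thus $\Omega$ is cyclic and separating for $\mathcal{A}$. The function $\log_\phi:(0,+\infty)\to\mathbb{R}$ is $\log_\phi(v)=v-1+\log v$, and $\exp_\phi:\mathbb{R}\to(0,+\infty)$ is its inverse. Functions of self-adjoint operators are defined by the spectral theorem. If $H=\int\lambda\,\mathrm{d}E_\lambda$ is the spectral decomposition, $\langle H\rangle_\omega=\int\lambda\,\mathrm{d}(E_\lambda\Omega,\Omega)$, which converges absolutely when $\Omega$ is in the domain of $|H|^{1/2}$. When $\Omega$ is in the domain of $|H|^{1/2}$ and $\langle H\rangle_\omega=0$, $\alpha(H)$ denotes the unique non-negative number for which $\|[\exp_\phi(H-\alpha(H))]^{1/2}\Omega\|=1$ (such a number exists and is unique). *)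

(* Defs.v *)
From HB Require Import structures.
From mathcomp Require Import all_boot all_order all_algebra.
From mathcomp Require Import all_classical all_reals all_analysis.
From mathcomp Require Export complex.

Set Implicit Arguments.
Unset Strict Implicit.
Unset Printing Implicit Defensive.

Import Order.TTheory GRing.Theory Num.Theory.
Import numFieldNormedType.Exports.

Local Open Scope classical_set_scope.
Local Open Scope ring_scope.
Local Open Scope complex_scope.

Section PhiExponential.
Context {R : realType}.

Definition log_phi (v : R) : R := v - 1 + ln v.

Definition exp_phi : R -> R := 'pinv_(fun=> 1) [set v | 0 < v] log_phi.

End PhiExponential.

(* A Hilbert space is a complete normed space over R[i] with an inner product
   dot satisfying `|x| ^+ 2 = dot x x.  The library's {dot V for Num.conj} is
   linear in its first argument and conjugate-linear in its second one. *)
Section HilbertSpace.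
Context {R : realType} {V : completeNormedModType R[i]}.

Section BoundedOperators.
Context (dot : {dot V for Num.conj}).

Definition bounded_op : set (V -> V) := [set a | linear a /\ continuous a].

Definition adjoint_of (a b : V -> V) := forall x y, dot (a x) y = dot x (b y).

Definition op_le (a b : V -> V) := forall x, dot (a x) x <= dot (b x) x.

Definition unitary_op (u : V -> V) :=
  (forall x y, dot (u x) (u y) = dot x y) /\ range u = setT.

Definition commutant (A : set (V -> V)) : set (V -> V) :=
  [set b | bounded_op b /\ forall a, A a -> a \o b = b \o a].

(* The equality A'' = A entails that A is a unital subalgebra. *)
Definition von_neumann_algebra (A : set (V -> V)) :=
  [/\ A `<=` bounded_op,
      forall a, A a -> exists2 b, A b & adjoint_of a b
    & commutant (commutant A) = A].

Definition orbit_of (A : set (V -> V)) (x : V) : set V :=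
  [set a x | a in A].

Definition cyclic_vector (A : set (V -> V)) (x : V) := dense (orbit_of A x).

Definition separating_vector (A : set (V -> V)) (x : V) :=
  forall a, A a -> a x = 0 -> a = (fun=> 0).

Definition state_on (A : set (V -> V)) (omega : (V -> V) -> R[i]) :=
  [/\ forall c a b, A a -> A b ->
        omega (fun x => c *: a x + b x) = c * omega a + omega b,
      forall a, A a -> op_le (fun=> 0) a -> 0 <= omega a
    & omega id = 1].

Definition faithful_on (A : set (V -> V)) (omega : (V -> V) -> R[i]) :=
  forall a, A a -> op_le (fun=> 0) a -> omega a = 0 -> a = (fun=> 0).

Definition directed_family (D : set (V -> V)) :=
  D !=set0 /\
  forall a b, D a -> D b -> exists c, [/\ D c, op_le a c & op_le b c].

Definition op_sup (A D : set (V -> V)) (s : V -> V) :=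
  [/\ A s, forall a, D a -> op_le a s
    & forall b, A b -> (forall a, D a -> op_le a b) -> op_le s b].

Definition normal_on (A : set (V -> V)) (omega : (V -> V) -> R[i]) :=
  forall (D : set (V -> V)) s,
    D `<=` A -> (forall a, D a -> op_le (fun=> 0) a) -> directed_family D ->
    op_sup A D s -> supremums (omega @` D) (omega s).

(* The identity representation of A with the vector Omega is the GNS
   representation of omega. *)
Definition gns_vector (A : set (V -> V)) (omega : (V -> V) -> R[i])
    (Omega : V) :=
  (forall a, A a -> omega a = dot (a Omega) Omega) /\ cyclic_vector A Omega.

End BoundedOperators.

(* Unbounded operators; the values outside the domain are irrelevant. *)
Record operator := Operator {
  dom : set V;
  op_fun :> V -> V;
  dom0 : dom 0;
  op_linear : forall c x y, dom x -> dom y ->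
    dom (c *: x + y) /\ op_fun (c *: x + y) = c *: op_fun x + op_fun y }.

Definition restricted_graph (D : set V) (T : operator) : set (V * V) :=
  [set p | [/\ D p.1, dom T p.1 & p.2 = T p.1]].

Definition graph_of (T : operator) : set (V * V) := restricted_graph setT T.

Definition core_of (D : set V) (T : operator) :=
  D `<=` dom T /\ closure (restricted_graph D T) = graph_of T.

Lemma op_subC_linear (T : operator) (k : R[i]) c x y :
  dom T x -> dom T y ->
  dom T (c *: x + y) /\
  T (c *: x + y) - k *: (c *: x + y) = c *: (T x - k *: x) + (T y - k *: y).
Proof.
move=> Tx Ty; have [Txy ->] := op_linear c Tx Ty; split=> //.
by rewrite scalerDr opprD addrACA scalerBr !scalerA mulrC.
Qed.

Definition op_subC (T : operator) (k : R[i]) : operator :=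
  @Operator (dom T) (fun x => T x - k *: x) (dom0 T) (@op_subC_linear T k).

Section UnboundedOperators.
Context (dot : {dot V for Num.conj}).

Definition self_adjoint (T : operator) :=
  dense (dom T) /\
  graph_of T =
    [set p | forall x, dom T x -> dot (T x) p.1 = dot x p.2].

(* T is affiliated with M when u T u^* = T for all unitaries u of M'. *)
Definition affiliated (T : operator) (M : set (V -> V)) :=
  forall u, commutant M u -> unitary_op dot u ->
    forall x y, graph_of T (x, y) <-> graph_of T (u x, u y).

Notation borel := (measurableTypeR R).

(* Countable additivity is required of B |-> (E(B) x, x), which equals
   B |-> `|E(B) x| ^+ 2 since E(B) is an orthogonal projection. *)
Record spectral_measure := SpectralMeasure {
  proj :> set borel -> V -> V;
  proj_linear : forall B, measurable B -> linear (proj B);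
  proj_sym : forall B x y, measurable B ->
    dot (proj B x) y = dot x (proj B y);
  projI : forall A B x, measurable A -> measurable B ->
    proj (A `&` B) x = proj A (proj B x);
  proj0 : forall x, proj set0 x = 0;
  projT : forall x, proj setT x = x;
  proj_sigma_additive : forall x,
    semi_sigma_additive (fun B => (complex.Re `|proj B x| ^+ 2)%:E) }.

Section ScalarMeasure.
Context (E : spectral_measure) (x : V).

Definition scalar_measure (B : set borel) : \bar R :=
  (complex.Re `|E B x| ^+ 2)%:E.

Let scalar_measure0 : scalar_measure set0 = 0%E.
Proof. by rewrite /scalar_measure proj0 normr0 expr0n. Qed.

Let scalar_measure_ge0 B : (0 <= scalar_measure B)%E.
Proof. by rewrite lee_fin sqr_ge0. Qed.

HB.instance Definition _ := isMeasure.Build _ _ _ scalar_measure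
  scalar_measure0 scalar_measure_ge0 (@proj_sigma_additive E x).

End ScalarMeasure.

(* T is the integral of the real Borel function f with respect to E: a linear
   operator with this (dense) domain is determined by its quadratic form. *)
Definition spectral_integral (E : spectral_measure) (f : R -> R)
    (T : operator) :=
  dom T = [set x | (\int[scalar_measure E x]_l ((f l) ^+ 2)%:E < +oo)%E] /\
  forall x, dom T x ->
    dot (T x) x = (\int[scalar_measure E x]_l f l)%:C.

Definition spectral_decomposition (T : operator) (E : spectral_measure) :=
  spectral_integral E id T.

(* function_of f T S reads S = f(T).  It is a relation because the spectral
   theorem is not available to turn T into its spectral measure; the spectral
   measure of a self-adjoint operator exists and is unique. *)
Definition function_of (f : R -> R) (T S : operator) :=
  exists2 E, spectral_decomposition T E & spectral_integral E f S.

Definition sqrt_abs_of (T S : operator) :=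
  exists2 absT, function_of Num.norm T absT & function_of Num.sqrt absT S.

Definition mean_is (T : operator) (x : V) (m : R) :=
  exists E, [/\ spectral_decomposition T E,
    (scalar_measure E x).-integrable setT (EFin : borel -> \bar R)
    & \int[scalar_measure E x]_l l = m].

Definition exp_phi_of (H : operator) (a : R) (X : operator) :=
  function_of exp_phi (op_subC H a%:C) X.

Definition is_alpha (H : operator) (x : V) (a : R) :=
  0 <= a /\ exists X Y, [/\ exp_phi_of H a X, function_of Num.sqrt X Y,
    dom Y x & `|Y x| = 1].

End UnboundedOperators.
End HilbertSpace.

(* Main.v *)
(* Let G be the spectral measure of H. The operators |H|^(1/2) and X^(1/2) are
   f(H) and g(H) with f(l)^2 = |l| and g(l)^2 = exp_phi(l - alpha), and the
   comparison exp_phi(l - alpha) <= exp_phi(l) <= 1 + |l| gives 1), 2) and 4).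
   Since H is affiliated with A', G commutes with A, hence so does X^(1/2):
   a X^(1/2) Omega = X^(1/2) a Omega. Then 3) follows from the injectivity of
   X^(1/2), and 5) from the density of its range, both due to g > 0.
   That the several spectral measures hidden in the functional calculus agree is
   the uniqueness of the spectral measure of an operator T: by the identity
   |T x|^2 = \int l^2 d|E x|^2, the range of E [m - r, m + r] consists of the x
   with |(T - m)^n x| <= r^n |x| for all n. *)

From HB Require Import structures.
Require Import Defs.
From mathcomp Require Import all_boot all_order all_algebra.
From mathcomp Require Import all_classical all_reals all_analysis.
From mathcomp Require Import measurable_realfun.
From mathcomp Require Import ring lra.
Set Implicit Arguments.
Unset Strict Implicit.
Unset Printing Implicit Defensive.
Import Order.TTheory GRing.Theory Num.Theory.
Import numFieldNormedType.Exports.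
Local Open Scope classical_set_scope.
Local Open Scope ring_scope.
Local Open Scope complex_scope.

(** The definition of a spectral integral records only the domain and the mean (T x, x), so even |T
    x|^2 = \int l^2 d|E x|^2 has to be earned. Polarizing means shows that T is symmetric and
    commutes with E. On the range of E B, for B within distance r of m, the symmetric operator T - m
    then has numerical radius at most r, hence norm at most r. So |T x|^2 and the second moment
    differ there by at most r^2 |x|^2, and subdividing B removes the error. Statements about
    unbounded T are tested on the vectors E [-n, n) x, where T is bounded. A function f(H) gets no
    theory of its own: its spectral measure is the image of G under f, so whatever holds for
    spectral decompositions applies to |H|^(1/2) and X^(1/2). Affiliation only speaks of the
    unitaries of A'' = A. Passing from them to all of A uses Cayley transforms of small Hermitian
    elements, built by a fixed-point iteration, so no functional calculus inside A is involved. *)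

Section PhiExponentialTheory.
Context {R : realType}.
Implicit Types l v w : R.

Lemma log_phi_lt v w : 0 < v -> v < w -> log_phi v < log_phi w.
Proof.
move=> v0 vw; have lnvw : ln v < ln w by rewrite ltr_ln // posrE; lra.
rewrite /log_phi; lra.
Qed.

(** Substituting v = exp t gives the function [h], continuous on the whole line, which avoids a
    limit at 0. The bracket for the intermediate value theorem comes from h(-|l|) <= -|l| <= l and
    h(|l|) >= 2|l| >= l. *)
Lemma log_phi_surj : set_surj [set v : R | 0 < v] setT log_phi.
Proof.
move=> l _; pose h (t : R) := expR t - 1 + t.
have hc : continuous h.
  move=> t; apply: cvgD => //; apply: cvgB; last exact: cvg_cst.
  exact: continuous_expR.
have h1 : h (- `|l|) <= l.
  have e : expR (- `|l|) <= 1 by rewrite -expR0 ler_expR oppr_le0.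
  have := ler_norm (- l); rewrite normrN /h; lra.
have h2 : l <= h `|l|.
  by have := expR_ge1Dx `|l|; have := ler_norm l; have := normr_ge0 l; rewrite /h; lra.
have ab : - `|l| <= `|l| by have := normr_ge0 l; lra.
have [|t _ <-] := IVT (v := l) ab (continuous_subspaceT hc).
  by rewrite ge_min h1 le_max h2 orbT.
by exists (expR t); rewrite /= ?expR_gt0 // /log_phi expRK.
Qed.

Lemma exp_phi_gt0 l : 0 < exp_phi l.
Proof. by apply: (surjpinv_image_sub log_phi_surj); exists l. Qed.

Lemma exp_phiK l : log_phi (exp_phi l) = l.
Proof. by rewrite (surjpK _ log_phi_surj) // inE. Qed.

Lemma le_exp_phi l w : 0 < w -> l <= log_phi w -> exp_phi l <= w.
Proof.
move=> w0; apply: contra_le => we.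
by rewrite -[ltRHS]exp_phiK; exact: log_phi_lt.
Qed.

Lemma exp_phi_nondecreasing : nondecreasing_fun (@exp_phi R).
Proof.
by move=> l w lw; apply: le_exp_phi; [exact: exp_phi_gt0|rewrite exp_phiK].
Qed.

(** At 1 + |l| the value of [log_phi] is |l| + ln(1 + |l|), which is at least l. *)
Lemma exp_phi_le l : exp_phi l <= 1 + `|l|.
Proof.
apply: le_exp_phi; first by rewrite ltr_pwDl.
rewrite /log_phi; have := ln_ge0 (x := 1 + `|l|); rewrite lerDl => /(_ (normr_ge0 l)).
have := ler_norm l; lra.
Qed.

End PhiExponentialTheory.

Section HilbertSpaceTheory.
Context {R : realType} {V : completeNormedModType R[i]}.
Context (dot : {dot V for Num.conj}).
Context (norm_dot : forall x : V, `|x| ^+ 2 = dot x x).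

(** * The inner product *)

(** The norm and [dot] take values in [R[i]]. Their real parts [sqnorm] and [rdot] bring every
    estimate into the ordered field [R], and [rdot] still separates vectors. *)
Definition sqnorm (x : V) : R := complex.Re `|x| ^+ 2.
Definition rdot (x y : V) : R := complex.Re (dot x y).
Local Notation sq := sqnorm.

Lemma Re_normK (x : V) : (complex.Re `|x|)%:C = `|x|.
Proof. by apply: RRe_real; exact: normr_real. Qed.

Lemma sqnormE x : (sq x)%:C = `|x| ^+ 2.
Proof. by rewrite /sqnorm rmorphXn /= Re_normK. Qed.

Lemma dot_sqnorm x : dot x x = (sq x)%:C.
Proof. by rewrite sqnormE norm_dot. Qed.

Lemma rdot_sqnorm x : rdot x x = sq x.
Proof. by rewrite /rdot dot_sqnorm. Qed.

Lemma sqnorm_ge0 x : 0 <= sq x.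
Proof. exact: sqr_ge0. Qed.

Lemma sqnorm_eq0 x : (sq x == 0) = (x == 0).
Proof.
by rewrite -(inj_eq (@complexI R)) sqnormE sqrf_eq0 normr_eq0.
Qed.

Lemma sqnorm0 : sq 0 = 0.
Proof. by apply/eqP; rewrite sqnorm_eq0. Qed.

Lemma rdotC x y : rdot x y = rdot y x.
Proof.
rewrite /rdot hermC /= expr0 mul1r.
by case: (dot y x).
Qed.

Lemma dotC x y : dot x y = (dot y x)^*.
Proof. by rewrite hermC /= expr0 mul1r. Qed.

Lemma rdotDl x y z : rdot (x + y) z = rdot x z + rdot y z.
Proof. by rewrite /rdot linearDl raddfD. Qed.

Lemma rdotNl x z : rdot (- x) z = - rdot x z.
Proof. by rewrite /rdot linearNl raddfN. Qed.

Lemma rdotZl (r : R) x z : rdot (r%:C *: x) z = r * rdot x z.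
Proof. by rewrite /rdot linearZl_LR /=; case: (dot x z) => a b /=; rewrite mul0r subr0. Qed.

Lemma rdotDr x y z : rdot z (x + y) = rdot z x + rdot z y.
Proof. by rewrite rdotC rdotDl !(rdotC z). Qed.

Lemma rdotNr x z : rdot z (- x) = - rdot z x.
Proof. by rewrite rdotC rdotNl !(rdotC z). Qed.

Lemma rdotZr (r : R) x z : rdot z (r%:C *: x) = r * rdot z x.
Proof. by rewrite rdotC rdotZl !(rdotC z). Qed.

Lemma dotE x y : dot x y = rdot x y +i* rdot x ('i%C *: y).
Proof.
rewrite /rdot linearZr_LR /=; case: (dot x y) => a b /=.
by congr (_ +i* _); rewrite !mul0r !mulN1r; ring.
Qed.

Lemma rdotii x y : rdot ('i%C *: x) ('i%C *: y) = rdot x y.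
Proof.
rewrite /rdot linearZr_LR linearZl_LR /=; case: (dot x y) => a b /=.
by ring.
Qed.

Lemma sqnormD x y : sq (x + y) = sq x + 2 * rdot x y + sq y.
Proof.
by rewrite -!rdot_sqnorm rdotDl !rdotDr (rdotC y x); ring.
Qed.

Lemma sqnormN x : sq (- x) = sq x.
Proof. by rewrite /sqnorm normrN. Qed.

Lemma sqnormB x y : sq (x - y) = sq x - 2 * rdot x y + sq y.
Proof. by rewrite sqnormD sqnormN rdotNr; ring. Qed.

Lemma sqnormBC x y : sq (x - y) = sq (y - x).
Proof. by rewrite -opprB sqnormN. Qed.

Lemma sqnormZ (r : R) x : sq (r%:C *: x) = r ^+ 2 * sq x.
Proof. by rewrite -!rdot_sqnorm rdotZl rdotZr; ring. Qed.

Lemma sqnormi x : sq ('i%C *: x) = sq x.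
Proof. by rewrite -!rdot_sqnorm rdotii. Qed.

Lemma sqnormD_le x y : sq (x + y) <= 2 * sq x + 2 * sq y.
Proof.
have := sqnorm_ge0 (x - y); rewrite sqnormB sqnormD; lra.
Qed.

Lemma rdot_parallel x y : 4 * rdot x y = sq (x + y) - sq (x - y).
Proof. by rewrite sqnormB sqnormD; ring. Qed.

Lemma eq0_rdot x : (forall y, rdot x y = 0) -> x = 0.
Proof. by move=> /(_ x)/eqP; rewrite rdot_sqnorm sqnorm_eq0 => /eqP. Qed.

Lemma rdot_inj x x' : (forall y, rdot x y = rdot x' y) -> x = x'.
Proof.
move=> h; apply/eqP; rewrite -subr_eq0; apply/eqP/eq0_rdot => y.
by rewrite rdotDl rdotNl h subrr.
Qed.

(** The form is real at x, at y and at x + i y. Expanding the last value leaves the two cross terms,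
    whose imaginary parts must cancel; that cancellation is the claimed equality of real parts. *)
Lemma sym_polarization (a : V -> V) (D : set V) :
  (forall x y, D x -> D y -> D (x + y) /\ a (x + y) = a x + a y) ->
  (forall x, D x -> D ('i%C *: x) /\ a ('i%C *: x) = 'i%C *: a x) ->
  (forall x, D x -> complex.Im (dot (a x) x) = 0) ->
  forall x y, D x -> D y -> rdot (a x) y = rdot x (a y).
Proof.
move=> aD ai aI x y Dx Dy.
have ReI z w : rdot z ('i%C *: w) = complex.Im (dot z w) by rewrite dotE.
have [Diy aiy] := ai _ Dy; have [Dix aix] := ai _ Dx.
have [Ds as_] := aD _ _ Dx Diy.
have := aI _ Ds; rewrite as_ -ReI aiy.
rewrite scalerDr !rdotDl !rdotDr !rdotii !ReI !aI //.
rewrite -ReI scalerA -expr2 sqr_i scaleN1r rdotNr (rdotC x); lra.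
Qed.

Lemma complex_gt0 (e : R[i]) : 0 < e -> exists2 r : R, 0 < r & e = r%:C.
Proof.
case: e => r s; rewrite ltcE /= => /andP[/eqP-> r0]; by exists r.
Qed.

Lemma Re_norm_ge0 (x : V) : 0 <= complex.Re `|x|.
Proof. rewrite -lecR Re_normK; exact: normr_ge0. Qed.

Lemma norm_lt_sqnorm (r : R) (x : V) : 0 < r -> (`|x| < r%:C) = (sq x < r ^+ 2).
Proof.
move=> r0; rewrite -Re_normK ltcR /sqnorm ltr_sqr // nnegrE ?Re_norm_ge0 // ltW //.
Qed.

Lemma norm_le_sqnorm (r : R) (x : V) : 0 <= r -> (`|x| <= r%:C) = (sq x <= r ^+ 2).
Proof.
move=> r0; rewrite -Re_normK lecR /sqnorm ler_sqr // nnegrE ?Re_norm_ge0 //.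
Qed.

Lemma nbhs_sqnormP (x : V) (B : set V) :
  nbhs x B <-> exists2 e : R, 0 < e & forall y, sq (x - y) < e -> B y.
Proof.
split=> [/nbhs_ballP[e /= /complex_gt0[r r0 ->] h]|[e e0 h]].
  exists (r ^+ 2); first exact: exprn_gt0.
  by move=> y; rewrite -norm_lt_sqnorm // => xy; apply: h; rewrite -ball_normE.
apply/nbhs_ballP; exists (Num.sqrt e)%:C => /=; first by rewrite ltcR sqrtr_gt0.
move=> y; rewrite -ball_normE /= norm_lt_sqnorm ?sqrtr_gt0 // sqr_sqrtr ?ltW //.
exact: h.
Qed.

Lemma dense_sqnormP (S : set V) :
  dense S <-> forall x (e : R), 0 < e -> exists2 y, S y & sq (x - y) < e.
Proof.
split=> [dS x e e0|h O [x Ox] oO].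
  have nO : nbhs x [set y | sq (x - y) < e] by apply/nbhs_sqnormP; exists e.
  have [||y [/interior_subset yx Sy]] := dS [set y | sq (x - y) < e]^°.
  - by exists x.
  - exact: open_interior.
  by exists y.
have /nbhs_sqnormP[e e0 he] : nbhs x O by rewrite nbhsE; exists O.
have [y Sy xy] := h x e e0.
by exists y; split => //; exact: he.
Qed.

Lemma closure_sqnormP (S : set (V * V)) p :
  closure S p <-> forall e : R, 0 < e ->
    exists q, [/\ S q, sq (p.1 - q.1) < e & sq (p.2 - q.2) < e].
Proof.
split=> [cS e e0|h B].
  have nB : nbhs p [set q | sq (p.1 - q.1) < e /\ sq (p.2 - q.2) < e].
    exists ([set y | sq (p.1 - y) < e], [set y | sq (p.2 - y) < e]) => /=.
      by split; apply/nbhs_sqnormP; exists e.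
    by case.
  by have [q [Sq [? ?]]] := cS _ nB; exists q.
move=> [[B1 B2] /= [/nbhs_sqnormP[e1 e10 h1] /nbhs_sqnormP[e2 e20 h2] sB]].
have e0 : 0 < Num.min e1 e2 by rewrite lt_min e10.
have [q [Sq q1 q2]] := h _ e0; exists q; split => //.
apply: sB; split => /=; [apply: h1|apply: h2].
  by apply: lt_le_trans q1 _; rewrite ge_min lexx.
by apply: lt_le_trans q2 _; rewrite ge_min lexx orbT.
Qed.

Lemma linear_continuousP (a : V -> V) : linear a ->
  continuous a <-> exists2 C : R, 0 <= C & forall x, sq (a x) <= C * sq x.
Proof.
move=> la.
pose am := GRing.isLinear.Build _ _ _ _ a la.
pose a' : {linear V -> V} := HB.pack a am.
split.
  move=> /(_ 0) ca.
  have /linear_boundedP : bounded_near a' (nbhs 0) by exact: continuous_linear_bounded.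
  move=> /pinfty_ex_gt0 [_ /complex_gt0[r r0 ->] h].
  exists (r ^+ 2) => [|x]; first exact: sqr_ge0.
  have := h x; rewrite /sqnorm -exprMn => hx.
  rewrite ler_sqr ?nnegrE ?mulr_ge0 ?Re_norm_ge0 ?(ltW r0) //.
  by rewrite -lecR rmorphM /= !Re_normK.
move=> [C C0 h].
suff : continuous a' by [].
apply: bounded_linear_continuous; apply/linear_boundedP.
exists (Num.sqrt C)%:C; split; first by apply/complex_realP; exists (Num.sqrt C).
move=> e /ltW he x; apply: le_trans (_ : (Num.sqrt C)%:C * `|x| <= _).
  rewrite -(Re_normK x) -rmorphM /= norm_le_sqnorm.
    by rewrite exprMn sqr_sqrtr //; exact: h.
  by rewrite mulr_ge0 ?sqrtr_ge0 ?Re_norm_ge0.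
by rewrite ler_wpM2r.
Qed.

(** * Bounded operators and the double commutant *)

Lemma geometric_small (q c e : R) : 0 <= q < 1 -> 0 < e ->
  exists N, forall n, (N <= n)%N -> q ^+ n * c < e.
Proof.
move=> /andP[q0 q1] e0.
have /cvgrPdist_lt : (q ^+ n * c) @[n --> \oo] --> (0 * c : R).
  by apply: cvgM; [apply: cvg_expr; rewrite ger0_norm|exact: cvg_cst].
move=> /(_ _ e0)[N _ h]; exists N => n Nn.
by have := h n Nn; rewrite mul0r sub0r normrN; exact: le_lt_trans (ler_norm _).
Qed.

Lemma linear_comb (a : V -> V) : linear a ->
  [/\ a 0 = 0, forall x y, a (x + y) = a x + a y,
      forall x y, a (x - y) = a x - a y & forall c x, a (c *: x) = c *: a x].
Proof.
move=> la.
have a0 : a 0 = 0.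
  by have := la (-1) 0 0; rewrite !scaleN1r oppr0 addr0 addNr.
have aZ c x : a (c *: x) = c *: a x.
  by have := la c x 0; rewrite a0 !addr0.
have aD x y : a (x + y) = a x + a y by have := la 1 x y; rewrite !scale1r.
by split => // x y; rewrite aD -scaleN1r aZ scaleN1r.
Qed.

(** The equation says that y is a fixed point of [g], which contracts distances by 1/2 because h has
    norm at most 1/2. The iteration from 0 converges by completeness. *)
Lemma resolvent_surj (h : V -> V) : linear h ->
  (forall x, sq (h x) <= 4^-1 * sq x) -> forall x, exists y, h y + 'i%C *: y = x.
Proof.
move=> lh hsq x; have [h0 hD hB hZ] := linear_comb lh.
pose g y := 'i%C *: (h y - x); pose y n := iter n g 0.
have gB u v : sq (g u - g v) <= 4^-1 * sq (u - v).
  by rewrite -scalerBr opprB addrA subrK sqnormi -hB.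
pose N (v : V) := complex.Re `|v|.
have ND u v : N (u + v) <= N u + N v.
  by rewrite -lecR rmorphD /= !Re_normK ler_normD.
have gN u v : N (g u - g v) <= 2^-1 * N (u - v).
  rewrite -ler_sqr ?nnegrE ?mulr_ge0 ?Re_norm_ge0 ?invr_ge0 //.
  apply: le_trans (gB _ _) _; rewrite exprMn /sqnorm ler_wpM2r ?sqr_ge0 //; lra.
pose c := N (y 1%N - y 0%N).
have step n : N (y n.+1 - y n) <= 2^-1 ^+ n * c.
  elim: n => [|n IH]; first by rewrite expr0 mul1r.
  apply: le_trans (gN _ _) _; rewrite exprS -mulrA ler_wpM2l // invr_ge0 //.
(* The subtracted tail of the geometric sum is kept so that the induction on [m] closes. *)
have tele n m : N (y (n + m)%N - y n) <= 2^-1 ^+ n * (2 * c) - 2^-1 ^+ (n + m) * (2 * c).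
  elim: m => [|m IH].
    by rewrite addn0 !subrr /N normr0.
  have := ND (y (n + m.+1)%N - y (n + m)%N) (y (n + m)%N - y n).
  rewrite addrA subrK; have := step (n + m)%N; rewrite addnS exprS; lra.
have c0 : 0 <= c by exact: Re_norm_ge0.
have tele2 n m : (n <= m)%N -> N (y m - y n) <= 2^-1 ^+ n * (2 * c).
  move=> nm; rewrite -(subnKC nm); apply: le_trans (tele _ _) _.
  by rewrite gerBl mulr_ge0 ?exprn_ge0 ?mulr_ge0 // invr_ge0.
have cy : cvgn y.
  apply/cauchy_cvgP; apply/cauchy_ballP => _ /complex_gt0[e e0 ->]; near_simpl.
  have h01 : 0 <= (2^-1 : R) < 1 by apply/andP; split; lra.
  have [M hM] := geometric_small (4 * c) h01 e0.
  exists ([set n | M <= n], [set n | M <= n])%N; first by split; exists M.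
  move=> [n m] [/= Mn Mm]; rewrite -ball_normE /= -Re_normK ltcR.
  have -> : y n - y m = (y n - y M) + (y M - y m) by rewrite addrA subrK.
  apply: le_lt_trans (ND _ _) _.
  have := tele2 _ _ Mn; have := tele2 _ _ Mm; have := hM M (leqnn _).
  rewrite /N (distrC (y M)); lra.
pose l := limn y; exists l.
suff : l = g l.
  move=> e; rewrite {2}e /g scalerA -expr2 sqr_i scaleN1r opprB addrCA subrr addr0 //.
have yl : y @ \oo --> l by exact: cy.
have small e : 0 < e -> exists n, sq (y n - l) < e /\ sq (y n.+1 - l) < e.
  move=> e0.
  have : nbhs l [set z | sq (l - z) < e] by apply/nbhs_sqnormP; exists e.
  move=> /yl[M _ hM]; exists M; rewrite !(sqnormBC _ l).
  by split; apply: hM => /=.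
apply/eqP; rewrite -subr_eq0 -sqnorm_eq0 eq_le sqnorm_ge0 andbT.
apply/ler_addgt0Pl => e e0; rewrite addr0.
have [n [h1 h2]] := small (4^-1 * e) ltac:(lra).
have -> : l - g l = (l - y n.+1) + (g (y n) - g l) by rewrite addrA subrK.
apply: le_trans (sqnormD_le _ _) _.
have := gB (y n) l; rewrite (sqnormBC l); lra.
Qed.

Lemma bounded_bound (a : V -> V) : bounded_op a ->
  exists2 C : R, 0 <= C & forall x, sq (a x) <= C * sq x.
Proof. by case=> la ca; apply/linear_continuousP. Qed.

Lemma sqnorm_bounded (a : V -> V) (C : R) : linear a -> 0 <= C ->
  (forall x, sq (a x) <= C * sq x) -> bounded_op a.
Proof. by move=> la C0 h; split=> //; apply/linear_continuousP => //; exists C. Qed.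

Lemma commutant_comb (B : set (V -> V)) a b (c d : R[i]) :
  B `<=` bounded_op -> commutant B a -> commutant B b ->
  commutant B (fun x => c *: a x + d *: b x).
Proof.
move=> Bb [[la ca] ha] [[lb cb] hb].
have [a0 aD aB aZ] := linear_comb la; have [b0 bD bB bZ] := linear_comb lb.
split; [split|].
- move=> k x y; rewrite aD aZ bD bZ !scalerDr !scalerA !(mulrC k).
  by rewrite addrACA.
- by move=> x; apply: cvgD; apply: cvgZr; [exact: ca|exact: cb].
- move=> g Bg; have [lg _] := Bb _ Bg; have [g0 gD gB gZ] := linear_comb lg.
  apply/funext => x /=; rewrite gD !gZ.
  by have /(congr1 (@^~ x)) /= -> := ha _ Bg; have /(congr1 (@^~ x)) /= -> := hb _ Bg.
Qed.

Lemma commutant_comp (B : set (V -> V)) a b :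
  commutant B a -> commutant B b -> commutant B (a \o b).
Proof.
move=> [[la ca] ha] [[lb cb] hb].
have [a0 aD aB aZ] := linear_comb la; have [b0 bD bB bZ] := linear_comb lb.
split; [split|].
- by move=> k x y /=; rewrite bD bZ aD aZ.
- by move=> x; apply: continuous_comp; [exact: cb|exact: ca].
- move=> g Bg; rewrite compA ha // -compA hb //.
Qed.

Lemma commutant_bounded (B : set (V -> V)) : commutant B `<=` bounded_op.
Proof. by move=> a []. Qed.

Lemma isometry_dot (u : V -> V) : linear u -> (forall x, sq (u x) = sq x) ->
  forall x y, dot (u x) (u y) = dot x y.
Proof.
move=> lu su x y; have [u0 uD uB uZ] := linear_comb lu.
have ru z w : rdot (u z) (u w) = rdot z w.
  have := rdot_parallel (u z) (u w); rewrite -uD -uB !su -rdot_parallel.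
  by move/(mulfI _); apply; rewrite pnatr_eq0.
by rewrite !dotE -uZ !ru.
Qed.

(* The unitary is the Cayley transform u = (h - i) (h + i)^-1; since
   1 - u = 2 i (h + i)^-1, whatever commutes with u commutes with h. *)
Lemma commute_small_hermitian (B : set (V -> V)) (b h : V -> V) :
  B `<=` bounded_op -> linear b ->
  (forall u, commutant B u -> unitary_op dot u -> u \o b = b \o u) ->
  commutant B h -> adjoint_of dot h h -> (forall x, sq (h x) <= 4^-1 * sq x) ->
  h \o b = b \o h.
Proof.
move=> Bb lb bu [[lh ch] hB'] hh hsq.
have [h0 hD hB hZ] := linear_comb lh; have [b0 bD bB bZ] := linear_comb lb.
have [r hr] := choice (resolvent_surj lh hsq).
have ReI y : rdot (h y) ('i%C *: y) = 0.
  have : dot (h y) y = (dot (h y) y)^* by rewrite -dotC hh.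
  by rewrite dotE; case=> e; lra.
(* Since (h y, y) is real, the cross term of h y and i y vanishes. Hence h + i and h - i have the
   same norm at every vector: the first is injective and the Cayley transform is isometric. *)
have sqp y : sq (h y + 'i%C *: y) = sq (h y) + sq y.
  by rewrite sqnormD ReI mulr0 addr0 sqnormi.
have sqm y : sq (h y - 'i%C *: y) = sq (h y) + sq y.
  by rewrite sqnormB ReI mulr0 subr0 sqnormi.
have inj y z : h y + 'i%C *: y = h z + 'i%C *: z -> y = z.
  move=> /eqP; rewrite -subr_eq0 opprD addrACA -hB -scalerBr -sqnorm_eq0 sqp.
  move=> e; apply/eqP; rewrite -subr_eq0 -sqnorm_eq0 eq_le sqnorm_ge0 andbT.
  by move: e => /eqP <-; rewrite lerDr sqnorm_ge0.
have lr : linear r.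
  move=> k x y; apply: inj; rewrite hr hD hZ scalerDr scalerA mulrC -scalerA.
  by rewrite addrACA -scalerDr !hr.
have [r0 rD rB rZ] := linear_comb lr.
pose u x := h (r x) - 'i%C *: r x.
have lu : linear u.
  move=> k x y; rewrite /u rD rZ hD hZ scalerDr opprD addrACA scalerBr !scalerA.
  by rewrite mulrC.
have su x : sq (u x) = sq x by rewrite /u sqm -sqp hr.
have uU : unitary_op dot u.
  split; first exact: isometry_dot.
  apply/seteqP; split => // z _.
  (* Surjectivity of [u]: solving h y - i y = z is the resolvent equation for - h with right-hand
     side - z. *)
  have lh' : linear (fun x => - h x).
    by move=> k x y; rewrite hD hZ opprD scalerN.
  have [|y hy] := resolvent_surj lh' _ (- z); first by move=> x; rewrite sqnormN.
  exists (h y + 'i%C *: y) => //=; rewrite /u.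
  have -> : r (h y + 'i%C *: y) = y by apply: inj; rewrite hr.
  by rewrite -[RHS]opprK -hy opprD opprK.
have cu : commutant B u.
  split; first by apply: (@sqnorm_bounded _ 1) => // x; rewrite su mul1r.
  move=> g Bg; have [lg _] := Bb _ Bg; have [g0 gD gB gZ] := linear_comb lg.
  have gh x : g (h x) = h (g x) by have /(congr1 (@^~ x)) := hB' _ Bg.
  have gr x : g (r x) = r (g x).
    by apply: inj; rewrite hr -gh -gZ -gD hr.
  by apply/funext => x /=; rewrite /u gB gZ gh !gr.
have ub x : u (b x) = b (u x) by have /(congr1 (@^~ x)) := bu _ cu uU.
have ur x : x - u x = 2 *: ('i%C *: r x).
  by rewrite -{1}(hr x) /u opprB addrC addrA subrK -mulr2n scaler_nat.
have br x : b (r x) = r (b x).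
  have i2 : 2 * 'i%C != 0 :> R[i] by rewrite mulf_neq0 ?pnatr_eq0 // eq_complex /= oner_eq0 andbF.
  have /(congr1 ( *:%R (2 * 'i%C)^-1)) : (2 * 'i%C) *: b (r x) = (2 * 'i%C) *: r (b x).
    by rewrite -bZ -!scalerA -!ur bB ub.
  by rewrite !scalerA mulVf // !scale1r.
apply/funext => x /=.
have : b (h x + 'i%C *: x) = h (b x) + 'i%C *: b x.
  have : r (b (h x + 'i%C *: x)) = b x.
    by rewrite -br; congr b; apply: inj; rewrite hr.
  by move=> /(congr1 (fun z => h z + 'i%C *: z)); rewrite hr.
by rewrite bD bZ => /addIr ->.
Qed.

(** An element is recovered from the Hermitian elements a + a' and i (a - a'), with a' its adjoint.
    Each of them, after scaling to norm at most 1/2, falls under the Cayley argument; adding the two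
    resulting identities yields 2 a. *)
Lemma commute_commutant (B : set (V -> V)) (b : V -> V) :
  B `<=` bounded_op -> linear b ->
  (forall a, commutant B a -> exists2 a', commutant B a' & adjoint_of dot a a') ->
  (forall u, commutant B u -> unitary_op dot u -> u \o b = b \o u) ->
  forall a, commutant B a -> a \o b = b \o a.
Proof.
move=> Bb lb Badj bu a Ba; have [b0 bD bB bZ] := linear_comb lb.
have herm h : commutant B h -> adjoint_of dot h h -> h \o b = b \o h.
  move=> Bh hh; have [[lh _] _] := Bh; have [h0 hD hB hZ] := linear_comb lh.
  have [C C0 hC] := bounded_bound (commutant_bounded Bh).
  (* Then t^2 C = C / (4 (C + 1)^2) <= 1/4; the added 1 keeps the denominator nonzero when C = 0. *)
  pose t : R := (2 * (C + 1))^-1.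
  have C1 : 0 < C + 1 by lra.
  have t0 : 0 < t by rewrite invr_gt0 mulr_gt0.
  have tC : t ^+ 2 * C <= 4^-1.
    have -> : t ^+ 2 * C = 4^-1 * (C / (C + 1) ^+ 2) by rewrite /t; field; rewrite gt_eqF.
    rewrite ler_piMr ?invr_ge0 // ler_pdivrMr ?exprn_gt0 // mul1r; nra.
  pose th x := t%:C *: h x.
  have Bth : commutant B th.
    have -> : th = (fun x => t%:C *: h x + 0 *: h x).
      by apply/funext => x; rewrite scale0r addr0.
    exact: commutant_comb.
  have thh : adjoint_of dot th th.
    move=> x y; rewrite /th linearZl_LR linearZr_LR /= hh.
    congr (_ * _); exact/esym/conjc_real.
  have thsq x : sq (th x) <= 4^-1 * sq x.
    rewrite sqnormZ; apply: le_trans (_ : t ^+ 2 * (C * sq x) <= _).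
      by rewrite ler_wpM2l ?sqr_ge0.
    by rewrite mulrA ler_wpM2r // sqnorm_ge0.
  have := commute_small_hermitian Bb lb bu Bth thh thsq.
  rewrite /th => e; apply/funext => x /=.
  have /(congr1 (@^~ x)) := e; rewrite /= bZ => /(congr1 ( *:%R (t%:C)^-1)).
  rewrite !scalerA mulVf ?scale1r //.
  by rewrite -(rmorph0 (real_complex R)) (inj_eq (@complexI R)) gt_eqF.
have [a' Ba' aa'] := Badj _ Ba.
have a'a : adjoint_of dot a' a by move=> x y; rewrite dotC -aa' -dotC.
pose h1 x := 1 *: a x + 1 *: a' x; pose h2 x := 'i%C *: a x + (- 'i%C) *: a' x.
have H1 : h1 \o b = b \o h1.
  apply: herm; first exact: commutant_comb.
  by move=> x y; rewrite /h1 !scale1r linearDl linearDr /= aa' a'a addrC.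
have H2 : h2 \o b = b \o h2.
  apply: herm; first exact: commutant_comb.
  move=> x y; rewrite /h2 linearDl linearDr /= !linearZl_LR !linearZr_LR /= aa' a'a.
  rewrite addrC; congr (_ * _ + _ * _); rewrite /=; congr (_ +i* _); ring.
apply/funext => x /=.
have /(congr1 (@^~ x)) /= := H1; have /(congr1 (@^~ x)) /= := H2.
rewrite /h1 /h2 !scale1r !bD !bZ !scaleNr => e2 e1.
have {}e2 : a (b x) - a' (b x) = b (a x) - b (a' x).
  have i0 : 'i%C != 0 :> R[i] by rewrite eq_complex /= oner_eq0 andbF.
  move: e2; rewrite -!scalerBr => /(congr1 ( *:%R ('i%C)^-1)).
  by rewrite !scalerA mulVf // !scale1r.
have : a (b x) *+ 2 = b (a x) *+ 2.
  have := congr2 +%R e1 e2; rewrite !addrA.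
  by rewrite ![_ + _ + _ - _]addrAC !addrK !mulr2n.
rewrite -[a _ *+ 2]scaler_nat -[b _ *+ 2]scaler_nat.
by move=> /(congr1 ( *:%R (2^-1))); rewrite !scalerA mulVf ?pnatr_eq0 // !scale1r.
Qed.

(** * Spectral measures *)

Lemma fin_num_scalar_measure (E : spectral_measure dot) (x : V) :
  fin_num_fun (scalar_measure E x).
Proof. by []. Qed.

HB.instance Definition _ (E : spectral_measure dot) (x : V) :=
  Measure_isFinite.Build _ _ _ (scalar_measure E x)
    (fin_num_scalar_measure E x).

Section ScalarMeasures.
Context (E : spectral_measure dot).
Implicit Types (A B : set (measurableTypeR R)) (x y : V).

Lemma scalar_measureE x B : scalar_measure E x B = (sq (E B x))%:E.
Proof. by []. Qed.

Lemma scalar_measureT x : scalar_measure E x setT = (sq x)%:E.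
Proof. by rewrite scalar_measureE projT. Qed.

Lemma spectral_projK B x : measurable B -> E B (E B x) = E B x.
Proof. by move=> mB; rewrite -projI // setIid. Qed.

Lemma rdot_proj B x y : measurable B -> rdot (E B x) y = rdot x (E B y).
Proof. by move=> mB; rewrite /rdot proj_sym. Qed.

Lemma sqnorm_proj B x : measurable B -> sq (E B x) = rdot (E B x) x.
Proof. by move=> mB; rewrite -rdot_sqnorm rdot_proj // spectral_projK // rdotC. Qed.

Lemma scalar_measure_proj A x B : measurable A -> measurable B ->
  scalar_measure E (E A x) B = scalar_measure E x (A `&` B).
Proof. by move=> mA mB; rewrite !scalar_measureE setIC projI. Qed.

Lemma sqnorm_projU A B x : measurable A -> measurable B -> A `&` B = set0 ->
  sq (E (A `|` B) x) = sq (E A x) + sq (E B x).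
Proof.
move=> mA mB AB; have := measureU (scalar_measure E x) mA mB AB.
by rewrite -EFinD => -[].
Qed.

Lemma sqnorm_projC B x : measurable B -> sq x = sq (E B x) + sq (E (~` B) x).
Proof.
move=> mB; rewrite -sqnorm_projU ?setICr ?setUv ?projT //; exact: measurableC.
Qed.

Lemma sqnorm_proj_le B x : measurable B -> sq (E B x) <= sq x.
Proof. by move=> mB; rewrite (sqnorm_projC x mB) lerDl sqnorm_ge0. Qed.

Lemma sqnorm_subproj B x : measurable B -> sq (x - E B x) = sq (E (~` B) x).
Proof.
move=> mB; rewrite sqnormB rdotC -sqnorm_proj // (sqnorm_projC x mB); ring.
Qed.

Lemma scalar_measureU A B x C : measurable A -> measurable B -> A `&` B = set0 ->
  measurable C -> scalar_measure E (E (A `|` B) x) C =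
  measure_add (scalar_measure E (E A x)) (scalar_measure E (E B x)) C.
Proof.
move=> mA mB AB mC; have mAB : measurable (A `|` B) by exact: measurableU.
rewrite measure_addE !scalar_measure_proj // setIUl measureU //; try exact: measurableI.
  by congr (_ + _)%E; exact/esym/scalar_measure_proj.
by rewrite setIACA AB set0I.
Qed.

(** Half open, because the bisection in [second_moment_itv] cuts intervals into disjoint half-open
    pieces. *)
Definition trunc (n : nat) : set (measurableTypeR R) := `[- n%:R, n%:R[%classic.

Lemma measurable_trunc n : measurable (trunc n).
Proof. exact: measurable_itv. Qed.
Hint Resolve measurable_trunc : core.

Lemma trunc_nondecreasing : {homo trunc : n m / (n <= m)%N >-> (n <= m)%O}.
Proof.
move=> n m nm; apply/subsetPset => l; rewrite /trunc /= !in_itv /= => /andP[h1 h2].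
have nm' : n%:R <= m%:R :> R by rewrite ler_nat.
by apply/andP; split; lra.
Qed.

Lemma bigcup_trunc : \bigcup_n trunc n = setT.
Proof.
apply/seteqP; split => // l _; exists (Num.truncn `|l|).+1 => //=.
rewrite /trunc /= in_itv /=; have := truncnS_gt `|l|; rewrite ltr_norml => /andP[h ->].
by rewrite ltW.
Qed.

Local Open Scope ereal_scope.

(** The measure of E B x agrees with that of x on subsets of B and gives no mass to the complement
    of B. *)
Lemma integral_scalar_measure_proj B x (f : R -> \bar R) : measurable B ->
  measurable_fun setT f -> (forall l, 0 <= f l) ->
  \int[scalar_measure E (E B x)]_l f l = \int[scalar_measure E x]_(l in B) f l.
Proof.
move=> mB mf f0; have mC := measurableC mB.
rewrite -(setUv B) ge0_integral_setU //; last 2 first.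
- by rewrite setUv.
- by apply/disj_setPS; rewrite setICr.
rewrite [X in _ + X]null_set_integral //; last 2 first.
- exact: measurable_funTS.
- transitivity (scalar_measure E x (B `&` ~` B)); last by rewrite setICr measure0.
  exact: scalar_measure_proj.
rewrite adde0; apply: eq_measure_integral => A mA AB.
by rewrite -[in RHS](setIidr AB); exact: scalar_measure_proj.
Qed.

Lemma integral_trunc_cvg x (f : R -> \bar R) :
  measurable_fun setT f -> (forall l, 0 <= f l) ->
  \int[scalar_measure E (E (trunc n) x)]_l f l @[n --> \oo] -->
  \int[scalar_measure E x]_l f l.
Proof.
move=> mf f0; under eq_fun do rewrite integral_scalar_measure_proj //.
rewrite -bigcup_trunc; apply: ge0_nondecreasing_set_cvg_integral => //.
- exact: trunc_nondecreasing.
- by move=> i; exact: measurable_funTS.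
Qed.

(** The integral of the constant 1 is the squared norm, so monotone convergence gives |E_n x|^2 ->
    |x|^2. By orthogonality the defect |x|^2 - |E_n x|^2 is |x - E_n x|^2. *)
Lemma trunc_approx x (e : R) : (0 < e)%R ->
  exists N, forall n, (N <= n)%N -> (sq (x - E (trunc n) x) < e)%R.
Proof.
move=> e0.
have := @integral_trunc_cvg x (cst 1) (@measurable_cst _ _ _ _ _ _) ltac:(by []).
under eq_fun do rewrite integral_cst //= mul1e scalar_measureT.
rewrite integral_cst //= mul1e scalar_measureT.
move=> /fine_cvgP[_ /cvgrPdist_lt/(_ _ e0)[N _ h]]; exists N => n Nn.
rewrite sqnorm_subproj //; have := h n Nn; rewrite /= (sqnorm_projC x (measurable_trunc n)).
by rewrite addrC addKr; apply: le_lt_trans; exact: ler_norm.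
Qed.

Local Close Scope ereal_scope.

Lemma trunc_ext x y : (forall n, E (trunc n) x = E (trunc n) y) -> x = y.
Proof.
move=> h; apply/eqP; rewrite -subr_eq0 -sqnorm_eq0 eq_le sqnorm_ge0 andbT.
apply/ler_addgt0Pl => e e0; rewrite addr0.
have e4 : 0 < e / 4 by lra.
have [N1 h1] := trunc_approx x e4; have [N2 h2] := trunc_approx y e4.
pose n := maxn N1 N2.
have := h1 n (leq_maxl _ _); have := h2 n (leq_maxr _ _); rewrite h => e1 e2.
have -> : x - y = (x - E (trunc n) y) + (E (trunc n) y - y) by rewrite addrA subrK.
apply: le_trans (sqnormD_le _ _) _.
rewrite (sqnormBC _ y); lra.
Qed.

End ScalarMeasures.

(** * Spectral decompositions *)

Section Operators.
Context (T : @operator R V).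

Lemma domD x y : dom T x -> dom T y -> dom T (x + y).
Proof. by move=> Tx Ty; have [] := op_linear 1 Tx Ty; rewrite scale1r. Qed.

Lemma opD x y : dom T x -> dom T y -> T (x + y) = T x + T y.
Proof. by move=> Tx Ty; have [_] := op_linear 1 Tx Ty; rewrite !scale1r. Qed.

Lemma op0 : T 0 = 0.
Proof.
have := opD (dom0 T) (dom0 T); rewrite addr0 => /(congr1 (fun z => z - T 0)).
by rewrite /= addrK subrr.
Qed.

Lemma domZ c x : dom T x -> dom T (c *: x).
Proof. by move=> Tx; have [] := op_linear c Tx (dom0 T); rewrite addr0. Qed.

Lemma opZ c x : dom T x -> T (c *: x) = c *: T x.
Proof. by move=> Tx; have [_] := op_linear c Tx (dom0 T); rewrite op0 !addr0. Qed.

Lemma domN x : dom T x -> dom T (- x).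
Proof. by move=> Tx; rewrite -scaleN1r; exact: domZ. Qed.

Lemma opN x : dom T x -> T (- x) = - T x.
Proof. by move=> Tx; rewrite -scaleN1r opZ // scaleN1r. Qed.

Lemma domB x y : dom T x -> dom T y -> dom T (x - y).
Proof. by move=> Tx Ty; apply: domD => //; exact: domN. Qed.

Lemma opB x y : dom T x -> dom T y -> T (x - y) = T x - T y.
Proof. by move=> Tx Ty; rewrite opD ?opN //; exact: domN. Qed.

End Operators.

Section SpectralDecomposition.
Context (E : spectral_measure dot) (T : @operator R V).
Context (TE : spectral_decomposition T E).
Implicit Types (B : set (measurableTypeR R)) (x y : V) (m r : R).
Local Notation mu := (scalar_measure E).
Local Notation borel := (measurableTypeR R).

Lemma spectral_domE x :
  dom T x = (\int[mu x]_l (l ^+ 2)%:E < +oo)%E :> Prop.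
Proof. by rewrite TE.1. Qed.

Lemma spectral_mean x : dom T x -> rdot (T x) x = \int[mu x]_l l.
Proof. by move=> Tx; rewrite /rdot TE.2. Qed.

Lemma spectral_sym x y : dom T x -> dom T y -> rdot (T x) y = rdot x (T y).
Proof.
move: x y; apply: sym_polarization => [x y Tx Ty|x Tx|x Tx].
- by split; [exact: domD|exact: opD].
- by split; [exact: domZ|exact: opZ].
- by rewrite TE.2.
Qed.

Lemma measurable_EFin_borel (D : set borel) : measurable_fun D (EFin : borel -> \bar R).
Proof. by apply/measurable_EFinP; exact: measurable_id. Qed.

Lemma measurable_sqr_borel (D : set borel) :
  measurable_fun D (fun l : borel => (l ^+ 2)%:E).
Proof.
by apply/measurable_funTS/measurable_EFinP; exact: exprn_measurable.
Qed.
Hint Resolve measurable_EFin_borel measurable_sqr_borel : core.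

Lemma integrable_cst x (c : R) : (mu x).-integrable setT (EFin \o cst c).
Proof. exact: finite_measure_integrable_cst. Qed.

Lemma integrable_sqr x : dom T x -> (mu x).-integrable setT (fun l : borel => (l ^+ 2)%:E).
Proof.
rewrite spectral_domE => Tx; apply/integrableP; split => //.
rewrite (eq_integral (fun l : borel => (l ^+ 2)%:E)) // => l _.
by rewrite gee0_abs // lee_fin sqr_ge0.
Qed.

Lemma integrable_id x : dom T x -> (mu x).-integrable setT (EFin : borel -> \bar R).
Proof.
move=> Tx; have : (mu x).-integrable setT (fun l : borel => (1 + l ^+ 2)%:E).
  have := integrableD measurableT (integrable_cst x 1) (integrable_sqr Tx).
  by congr (integrable _ _ _); apply/funext => l /=; rewrite EFinD.
apply: le_integrable => // l _; rewrite /= lee_fin [leRHS]ger0_norm; last by nra.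
by have [?|?] := ger0P l; nra.
Qed.

Lemma spectral_proj_dom B x : measurable B -> dom T x -> dom T (E B x).
Proof.
rewrite !spectral_domE => mB; apply: le_lt_trans.
rewrite integral_scalar_measure_proj //; last 2 first.
- exact: measurable_sqr_borel.
- by move=> l; rewrite lee_fin sqr_ge0.
by apply: ge0_subset_integral => // l _; rewrite lee_fin sqr_ge0.
Qed.

Lemma spectral_bounded_dom B x m r : measurable B ->
  (forall l, B l -> `|l - m| <= r) -> dom T (E B x).
Proof.
move=> mB Br; rewrite spectral_domE integral_scalar_measure_proj //; last 2 first.
- exact: measurable_sqr_borel.
- by move=> l; rewrite lee_fin sqr_ge0.
pose K : R := (`|m| + r) ^+ 2.
apply: (@le_lt_trans _ _ (\int[mu x]_(l in B) (cst K%:E l))%E).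
  apply: ge0_le_integral => //.
  - by move=> l _; rewrite lee_fin sqr_ge0.
  - move=> l Bl; rewrite lee_fin -real_normK ?num_real // ler_sqr ?nnegrE //.
      by have := Br _ Bl; have := ler_normD (l - m) m; rewrite subrK; lra.
    by have := Br _ Bl; have := normr_ge0 (l - m); have := normr_ge0 m; lra.
by rewrite integral_cst // -EFinM ltry.
Qed.

(** The second moment remains an integral in this formula: its value |T x|^2 becomes available only
    with [spectral_second_moment]. *)
Lemma Rintegral_shift_sqr x m : dom T x ->
  \int[mu x]_l ((l - m) ^+ 2) =
  \int[mu x]_l (l ^+ 2) - 2 * m * rdot (T x) x + m ^+ 2 * sq x.
Proof.
move=> Tx; have i1 := integrable_id Tx; have i2 := integrable_sqr Tx.
rewrite spectral_mean //.
have -> : m ^+ 2 * sq x = \int[mu x]_l (cst (m ^+ 2) l).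
  by rewrite Rintegral_cst // /= projT.
have -> : 2 * m * \int[mu x]_l l = \int[mu x]_l ((2 * m) * l).
  by rewrite RintegralZl.
have i3 : (mu x).-integrable setT (EFin \o (fun l : borel => 2 * m * l)).
  have := integrableZl (measurableT) (2 * m) i1.
  by congr (integrable _ _ _); apply/funext => l /=; rewrite EFinM.
rewrite -RintegralB // -RintegralD //; last 2 first.
- have := integrableB measurableT i2 i3.
  by congr (integrable _ _ _); apply/funext => l /=; rewrite EFinB.
- exact: integrable_cst.
by apply: eq_Rintegral => l _ /=; ring.
Qed.

Lemma spectral_variance_ge0 x m : dom T x ->
  0 <= \int[mu x]_l (l ^+ 2) - 2 * m * rdot (T x) x + m ^+ 2 * sq x.
Proof.
by move=> Tx; rewrite -Rintegral_shift_sqr // Rintegral_ge0 // => l _; exact: sqr_ge0.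
Qed.

Lemma integral_concentrated B x (f : borel -> \bar R) : measurable B ->
  (mu (E B x)).-integrable setT f ->
  (\int[mu (E B x)]_l f l = \int[mu (E B x)]_(l in B) f l)%E.
Proof.
move=> mB f_int; rewrite (@negligible_integral _ _ _ _ setT (~` B)) //.
- by rewrite setTD setCK.
- exact: measurableC.
- transitivity (mu x (B `&` ~` B)); last by rewrite setICr measure0.
  by apply: scalar_measure_proj => //; exact: measurableC.
Qed.

Lemma integral_concentrated_le B x (f : borel -> R) (c : R) : measurable B ->
  (mu (E B x)).-integrable setT (EFin \o f) ->
  (forall l, B l -> f l <= c) -> \int[mu (E B x)]_l f l <= c * sq (E B x).
Proof.
move=> mB f_int fc.
have e : (\int[mu (E B x)]_(l in B) (cst c%:E l) = (c * sq (E B x))%:E)%E.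
  by rewrite integral_cst //= scalar_measureE spectral_projK.
rewrite /Rintegral -[leRHS]/(fine (_%:E)) -e fine_le //.
- exact: integrable_fin_num.
- by rewrite e.
- rewrite integral_concentrated //; apply: le_integral => //.
  + exact: integrableS f_int.
  + exact: finite_measure_integrable_cst.
  + by move=> l /set_mem Bl; rewrite lee_fin fc.
Qed.

Lemma spectral_mean_bound B x m r : measurable B ->
  (forall l, B l -> `|l - m| <= r) ->
  `|rdot (T (E B x)) (E B x) - m * sq (E B x)| <= r * sq (E B x).
Proof.
move=> mB Br; have Tx : dom T (E B x) by exact: spectral_bounded_dom Br.
have i1 := integrable_id Tx.
rewrite ler_norml spectral_mean //; apply/andP; split.
  have := @integral_concentrated_le B x (fun l => -1 * l) (r - m) mB.
  rewrite RintegralZl // => h.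
  rewrite -lerN2; have : -1 * \int[mu (E B x)]_l l <= (r - m) * sq (E B x).
    apply: h => [|l Bl].
      have := integrableZl measurableT (-1) i1.
      by congr (integrable _ _ _); apply/funext => l /=; rewrite EFinM.
    by have := Br _ Bl; rewrite ler_norml; lra.
  lra.
have : \int[mu (E B x)]_l l <= (m + r) * sq (E B x).
  apply: integral_concentrated_le => // l Bl.
  by have := Br _ Bl; rewrite ler_norml; lra.
lra.
Qed.

Lemma spectral_variance_le B x m r : measurable B -> 0 <= r ->
  (forall l, B l -> `|l - m| <= r) ->
  \int[mu (E B x)]_l (l ^+ 2) - 2 * m * rdot (T (E B x)) (E B x) + m ^+ 2 * sq (E B x)
  <= r ^+ 2 * sq (E B x).
Proof.
move=> mB r0 Br; have Tx : dom T (E B x) by exact: spectral_bounded_dom Br.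
rewrite -Rintegral_shift_sqr //; apply: integral_concentrated_le => //.
- have i1 := integrable_id Tx; have i2 := integrable_sqr Tx.
  have := integrableD measurableT (integrableB measurableT i2
    (integrableZl measurableT (2 * m) i1)) (integrable_cst (E B x) (m ^+ 2)).
  congr (integrable _ _ _); apply/funext => l /=.
  by congr EFin; ring.
- by move=> l Bl; rewrite -real_normK ?num_real // ler_sqr ?nnegrE // Br.
Qed.

Lemma proj_comb B : measurable B ->
  [/\ E B 0 = 0, forall x y, E B (x + y) = E B x + E B y,
      forall x y, E B (x - y) = E B x - E B y & forall c x, E B (c *: x) = c *: E B x].
Proof. by move=> mB; apply: linear_comb; exact: proj_linear. Qed.

Lemma trunc_bound n (l : R) : trunc n l -> `|l - 0| <= n%:R.
Proof.
by rewrite /trunc /= in_itv /= subr0 ler_norml => /andP[-> /ltW ->].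
Qed.

Lemma trunc_dom n x : dom T (E (trunc n) x).
Proof. exact: spectral_bounded_dom (measurable_trunc n) (@trunc_bound n). Qed.

Lemma spectral_dom_ext u v : (forall y, dom T y -> rdot u y = rdot v y) -> u = v.
Proof.
move=> h; apply: (trunc_ext (E := E)) => n; apply: rdot_inj => y.
have mn := @measurable_trunc n.
by rewrite !rdot_proj //; apply: h; exact: trunc_dom.
Qed.

(** Polarization at the level of measures. Since a commutes with E and has adjoint b, the measures
    of a x + y and x - b y have the same sum as those of a x - y and x + b y. Integrating l against
    both sums compares the cross terms of the means. Sums replace differences so that only positive
    measures occur. *)
Lemma spectral_commute_form (a b : V -> V) : linear a -> linear b ->
  (forall x y, rdot (a x) y = rdot x (b y)) ->
  (forall B, measurable B -> forall x, E B (a x) = a (E B x)) ->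
  forall x y, dom T x -> dom T y -> dom T (a x) -> dom T (b y) ->
  rdot (T (a x)) y = rdot (T x) (b y).
Proof.
move=> la lb ab aE x y Tx Ty Tax Tby.
pose J z := \int[mu z]_l l.
have JD z1 z2 : dom T z1 -> dom T z2 ->
    J z1 + J z2 = fine (\int[measure_add (mu z1) (mu z2)]_l l%:E)%E.
  move=> Tz1 Tz2; have i1 := integrable_id Tz1; have i2 := integrable_id Tz2.
  by rewrite integral_measure_add // fineD //; exact: integrable_fin_num.
have : J (a x + y) + J (x - b y) = J (a x - y) + J (x + b y).
  rewrite !JD; try by [exact: domD|exact: domB].
  congr fine; apply: eq_measure_integral => B mB _.
  have AE z1 z2 : measure_add (mu z1) (mu z2) B = (sq (E B z1) + sq (E B z2))%:E.
    by rewrite measure_addE.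
  apply: etrans (AE _ _) _; apply: etrans (esym (AE _ _)); congr EFin.
  have [_ ED EB _] := proj_comb mB.
  rewrite !EB !ED !sqnormB !sqnormD aE // ab.
  have -> : rdot (E B x) (E B (b y)) = rdot (E B x) (b (E B y)).
    transitivity (rdot (a (E B x)) y).
      by rewrite rdot_proj // spectral_projK // -rdot_proj // ab.
    by rewrite -[RHS]ab -[RHS]rdot_proj // aE // spectral_projK.
  ring.
rewrite /J -!spectral_mean; try by [exact: domD|exact: domB].
rewrite !opB // !opD // !rdotDl !rdotDr !rdotNl !rdotNr.
rewrite (spectral_sym Ty Tax) (rdotC _ y) (spectral_sym Tby Tx) (rdotC (b y)).
rewrite (rdotC y (T (a x))); lra.
Qed.

Lemma spectral_proj_commute B x : measurable B -> dom T x -> T (E B x) = E B (T x).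
Proof.
move=> mB Tx; apply: spectral_dom_ext => y Ty; have [? ? ? ?] := proj_comb mB.
rewrite rdot_proj //; apply: spectral_commute_form => //.
- exact: proj_linear.
- exact: proj_linear.
- by move=> *; exact: rdot_proj.
- by move=> C mC z; rewrite -!projI // setIC.
- exact: spectral_proj_dom.
- exact: spectral_proj_dom.
Qed.

(** A symmetric operator is bounded by its numerical radius. With z = (T - m) w, the form of T - m
    at w + t z minus that at w - t z is 4 t |z|^2, while the mean bound and the parallelogram law
    majorize it by 2 r (|w|^2 + t^2 |z|^2). The choice t = 1/r gives the claim. *)
Lemma spectral_local_bound B x m r : measurable B -> 0 <= r ->
  (forall l, B l -> `|l - m| <= r) ->
  sq (T (E B x) - m%:C *: E B x) <= r ^+ 2 * sq (E B x).
Proof.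
move=> mB r0 Br; have [_ ED EB EZ] := proj_comb mB.
set w := E B x.
have Bdom z : dom T (E B z) by exact: spectral_bounded_dom Br.
have Tw : dom T w by exact: Bdom.
have Ew : E B w = w by exact: spectral_projK.
have [z zE] : exists z, z = T w - m%:C *: w by eexists.
rewrite -zE; have Ez : E B z = z by rewrite zE EB EZ -spectral_proj_commute // Ew.
have Tz : dom T z by rewrite -Ez; exact: Bdom.
have q v : E B v = v -> `|rdot (T v) v - m * sq v| <= r * sq v.
  by move=> <-; exact: spectral_mean_bound.
have main t : 4 * t * sq z <= 2 * r * (sq w + t ^+ 2 * sq z).
  have Ttz : dom T (t%:C *: z) by exact: domZ.
  have := q (w + t%:C *: z); rewrite ED EZ Ew Ez => /(_ erefl).
  have := q (w - t%:C *: z); rewrite EB EZ Ew Ez => /(_ erefl).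
  rewrite opB // opD // opZ // !sqnormB !sqnormD !rdotDl !rdotDr !rdotNl !rdotNr.
  rewrite !rdotZl !rdotZr !sqnormZ (spectral_sym Tz Tw) (rdotC z (T w)).
  have : sq z = rdot (T w) z - m * rdot w z.
    by rewrite -rdot_sqnorm {1}zE rdotDl rdotNl rdotZl.
  move=> /(congr1 (fun u => t * u)) /= e.
  rewrite !ler_norml => /andP[h1 h2] /andP[h3 h4]; lra.
have [r_gt0|r_le0] := ltP 0 r.
  have := main r^-1 => h.
  have : r * (4 * r^-1 * sq z) <= r * (2 * r * (sq w + r^-1 ^+ 2 * sq z)).
    by rewrite ler_pM2l.
  have -> : r * (4 * r^-1 * sq z) = 4 * sq z by field; rewrite gt_eqF.
  have -> : r * (2 * r * (sq w + r^-1 ^+ 2 * sq z)) = 2 * r ^+ 2 * sq w + 2 * sq z.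
    by field; rewrite gt_eqF.
  lra.
(* For r = 0 the choice t = 1 already forces z = 0. *)
have -> : r = 0 by apply/eqP; rewrite eq_le r_le0.
have := main 1; have -> : r = 0 by apply/eqP; rewrite eq_le r_le0.
by rewrite expr0n /= !mulr0 !mul0r mulr1; lra.
Qed.

Lemma second_momentU A B x : measurable A -> measurable B -> A `&` B = set0 ->
  dom T x ->
  \int[mu (E (A `|` B) x)]_l (l ^+ 2) =
  \int[mu (E A x)]_l (l ^+ 2) + \int[mu (E B x)]_l (l ^+ 2).
Proof.
move=> mA mB AB Tx.
have iA := integrable_sqr (spectral_proj_dom mA Tx).
have iB := integrable_sqr (spectral_proj_dom mB Tx).
rewrite /Rintegral -fineD; try exact: integrable_fin_num.
rewrite -integral_measure_add //; congr fine; apply: eq_measure_integral => C mC _.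
exact: scalar_measureU.
Qed.

Local Notation co u v := (`[u, v[%classic : set (measurableTypeR R)).

(* Halving the interval j times divides the a priori error, which is quadratic
   in the length of the interval, by 4 ^ j. *)
Lemma second_moment_itv x (u v : R) : dom T x -> u <= v ->
  sq (T (E (co u v) x)) = \int[mu (E (co u v) x)]_l (l ^+ 2).
Proof.
move=> Tx uv.
have err j : forall u v, u <= v ->
    `|sq (T (E (co u v) x)) - \int[mu (E (co u v) x)]_l (l ^+ 2)| <=
    4^-1 ^+ j * (((v - u) / 2) ^+ 2 * sq (E (co u v) x)).
  elim: j => [{}u {}v {}uv|j IH {}u {}v {}uv].
    have mB : measurable (co u v) by exact: measurable_itv.
    have Br l : co u v l -> `|l - (u + v) / 2| <= (v - u) / 2.
      by rewrite /= in_itv /= ler_norml => /andP[? ?]; apply/andP; split; lra.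
    have r0 : 0 <= (v - u) / 2 by lra.
    have TB := spectral_proj_dom mB Tx.
    (* Shifting by the midpoint changes |T w|^2 and the second moment of w by the same terms, as
       both have the same mean. After the shift both lie between 0 and r^2 |w|^2, with r half the
       length, so they differ by at most that much. *)
    have := spectral_variance_ge0 ((u + v) / 2) TB.
    have := spectral_variance_le x mB r0 Br.
    have := spectral_local_bound x mB r0 Br.
    have := sqnorm_ge0 (T (E (co u v) x) - ((u + v) / 2)%:C *: E (co u v) x).
    rewrite sqnormB rdotZr sqnormZ expr0 mul1r ler_norml.
    move=> h1 h2 h3 h4; apply/andP; split; lra.
  pose m := (u + v) / 2.
  have um : u <= m by rewrite /m; lra.
  have mv : m <= v by rewrite /m; lra.
  have e : co u v = co u m `|` co m v.
    apply/seteqP; split => l /=; rewrite !in_itv /=.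
      move=> /andP[ul lv]; have [lm|ml] := ltP l m; first by left; rewrite ul.
      by right; rewrite lv.
    by case=> /andP[? ?]; apply/andP; split; lra.
  have mA : measurable (co u m) by exact: measurable_itv.
  have mB : measurable (co m v) by exact: measurable_itv.
  have AB : co u m `&` co m v = set0.
    apply/seteqP; split => l //=; rewrite !in_itv /= => -[/andP[_ h1] /andP[h2 _]]; lra.
  have mU := measurableU _ _ mA mB.
  have := IH _ _ um; have := IH _ _ mv.
  (* T commutes with E, so |T E x|^2 = |E T x|^2 is additive over the two halves, as are the second
     moment and |E x|^2. *)
  rewrite e second_momentU // !spectral_proj_commute // !sqnorm_projU //.
  have -> : (v - m) / 2 = (v - u) / 4 by rewrite /m; field.
  have -> : (m - u) / 2 = (v - u) / 4 by rewrite /m; field.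
  set a := sq _; set b := Rintegral _ _ _; set c := sq (E _ x).
  set a' := sq _; set b' := Rintegral _ _ _; set c' := sq (E _ x).
  move=> h h'; have -> : a' + a - (b' + b) = (a - b) + (a' - b') by ring.
  apply: le_trans (ler_normD _ _) _; apply: le_trans (lerD h h') _.
  by rewrite (exprS _ j); lra.
apply/eqP; rewrite -subr_eq0 -normr_eq0 eq_le normr_ge0 andbT.
apply/ler_addgt0Pl => e e0; rewrite addr0.
have q01 : 0 <= (4^-1 : R) < 1 by apply/andP; split; lra.
have [N /(_ N (leqnn _)) h] :=
  geometric_small (((v - u) / 2) ^+ 2 * sq (E (co u v) x)) q01 e0.
exact: le_trans (err N u v uv) (ltW h).
Qed.

Lemma integral_sqr_trunc x n : dom T x ->
  (\int[mu (E (trunc n) x)]_l (l ^+ 2)%:E = (sq (T (E (trunc n) x)))%:E)%E.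
Proof.
move=> Tx; rewrite /trunc second_moment_itv //; last first.
  by rewrite (@le_trans _ _ 0) // oppr_le0.
rewrite /Rintegral fineK //; apply: integrable_fin_num => //.
exact/integrable_sqr/spectral_proj_dom.
Qed.

Lemma integral_sqr_cvg x :
  (\int[mu (E (trunc n) x)]_l (l ^+ 2)%:E @[n --> \oo] -->
  \int[mu x]_l (l ^+ 2)%:E)%E.
Proof.
apply: integral_trunc_cvg; first exact: measurable_sqr_borel.
by move=> l; rewrite lee_fin sqr_ge0.
Qed.

(** Over [-n, n) the second moment is |T E_n x|^2 = |E_n T x|^2. The moments tend to the full
    integral and the norms tend to |T x|^2. *)
Lemma spectral_second_moment x : dom T x ->
  (\int[mu x]_l (l ^+ 2)%:E = (sq (T x))%:E)%E.
Proof.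
move=> Tx; have h1 := @integral_sqr_cvg x.
have := @integral_trunc_cvg E (T x) (cst 1%E) (@measurable_cst _ _ _ _ _ _)
  (fun=> lee01).
have e n : (\int[mu (E (trunc n) (T x))]_l cst 1%E l =
    \int[mu (E (trunc n) x)]_l (l ^+ 2)%:E)%E.
  rewrite integral_cst //= mul1e scalar_measureT integral_sqr_trunc //.
  by rewrite spectral_proj_commute //; exact: measurable_trunc.
under eq_fun do rewrite e.
rewrite integral_cst //= mul1e scalar_measureT => h2.
exact: cvg_unique h1 h2.
Qed.

(** Membership in the domain comes for free: the truncated second moments are |E_n y|^2 <= |y|^2, so
    their limit is finite. *)
Lemma spectral_graph_ext x y :
  (forall n, T (E (trunc n) x) = E (trunc n) y) -> dom T x /\ T x = y.
Proof.
move=> h; have mn := @measurable_trunc.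
have Tx : dom T x.
  rewrite spectral_domE; apply: (@le_lt_trans _ _ (sq y)%:E); last exact: ltry.
  rewrite -(cvg_lim _ (@integral_sqr_cvg x)) //; apply: lime_le.
    by apply/cvg_ex; eexists; exact: integral_sqr_cvg.
  apply: nearW => n; rewrite spectral_second_moment; last exact: trunc_dom.
  by rewrite h lee_fin sqnorm_proj_le.
by split=> //; apply: (trunc_ext (E := E)) => n; rewrite -spectral_proj_commute.
Qed.

Lemma spectral_commute (a b : V -> V) : linear a -> linear b ->
  (forall x y, rdot (a x) y = rdot x (b y)) ->
  (forall B, measurable B -> forall x, E B (a x) = a (E B x)) ->
  forall x, dom T x -> dom T (a x) /\ T (a x) = a (T x).
Proof.
move=> la lb ab aE x Tx; have mn := @measurable_trunc.
have bE B y : measurable B -> E B (b y) = b (E B y).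
  move=> mB; apply: rdot_inj => z; rewrite rdotC -rdot_proj // -ab -aE //.
  by rewrite rdot_proj // ab rdotC.
apply: spectral_graph_ext => n; rewrite aE // aE // -spectral_proj_commute //.
set w := E _ x; have Tw : dom T w by exact: trunc_dom.
have aw : E (trunc n) (a w) = a w by rewrite aE // spectral_projK.
have Ew : E (trunc n) w = w by exact: spectral_projK.
have Taw : dom T (a w) by rewrite -aw; exact: trunc_dom.
(* The test vector is truncated too, which puts it and its image under [b] in the domain, as the
   comparison of forms requires. *)
apply: (trunc_ext (E := E)) => k; apply: rdot_inj => z.
rewrite !rdot_proj // (spectral_commute_form la lb ab aE) //.
- exact: trunc_dom.
- by rewrite -bE //; exact: trunc_dom.
Qed.

Lemma sqnorm_op_trunc_le n x : sq (T (E (trunc n) x)) <= n%:R ^+ 2 * sq x.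
Proof.
have mn := @measurable_trunc n.
have := spectral_local_bound x mn (ler0n _ n) (@trunc_bound n).
rewrite scale0r subr0 => /le_trans; apply.
by rewrite ler_wpM2l ?sqr_ge0 // sqnorm_proj_le.
Qed.

(** T has norm at most n on the range of E_n, so the relation T E_n x = E_n y survives limits of
    graph points and determines (x, y) as a point of the graph. *)
Lemma spectral_closed : closure (graph_of T) = graph_of T.
Proof.
apply/seteqP; split; last exact: subset_closure.
move=> [x y] /closure_sqnormP h; have mn := @measurable_trunc.
suff /spectral_graph_ext[Tx <-] : forall n, T (E (trunc n) x) = E (trunc n) y.
  by split.
move=> n; apply/eqP; rewrite -subr_eq0 -sqnorm_eq0 eq_le sqnorm_ge0 andbT.
apply/ler_addgt0Pl => e e0; rewrite addr0.
(* Chosen so that 2 n^2 (e / K) + 2 (e / K) = e: the first term bounds the error in x after applying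
   T, the second the error in y. *)
pose K : R := 2 * n%:R ^+ 2 + 2.
have K0 : 0 < K by rewrite ltr_pwDr // mulr_ge0 // sqr_ge0.
have [[x' y'] [[/= _ Tx' ->] h1 h2]] := h (e / K) (divr_gt0 e0 K0).
have [_ ED EB EZ] := proj_comb (mn n).
have -> : T (E (trunc n) x) - E (trunc n) y =
    T (E (trunc n) (x - x')) - E (trunc n) (y - T x').
  rewrite !EB opB; try exact: trunc_dom.
  by rewrite -spectral_proj_commute // opprB addrA subrK.
apply: le_trans (sqnormD_le _ _) _; rewrite sqnormN.
have h3 : sq (T (E (trunc n) (x - x'))) <= n%:R ^+ 2 * (e / K).
  apply: le_trans (sqnorm_op_trunc_le _ _) _.
  by rewrite ler_wpM2l ?sqr_ge0 // ltW.
have h4 : sq (E (trunc n) (y - T x')) <= e / K.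
  by apply: le_trans (sqnorm_proj_le E _ (mn n)) _; exact: ltW.
have -> : e = 2 * (n%:R ^+ 2 * (e / K)) + 2 * (e / K).
  by rewrite /K; field; rewrite gt_eqF.
by rewrite lerD // ler_pM2l.
Qed.

Lemma second_momentE x : dom T x -> \int[mu x]_l (l ^+ 2) = sq (T x).
Proof. by move=> Tx; rewrite /Rintegral spectral_second_moment. Qed.

Lemma sqnorm_op_shift x m : dom T x ->
  sq (T x - m%:C *: x) = \int[mu x]_l ((l - m) ^+ 2).
Proof.
move=> Tx; rewrite Rintegral_shift_sqr // second_momentE // sqnormB rdotZr sqnormZ; ring.
Qed.

Lemma spectral_lower_bound B x m s : measurable B -> 0 <= s -> dom T x ->
  (forall l, B l -> s <= `|l - m|) ->
  s ^+ 2 * sq (E B x) <= sq (T (E B x) - m%:C *: E B x).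
Proof.
move=> mB s0 Tx Bs; have TB := spectral_proj_dom mB Tx.
have i1 := integrable_id TB; have i2 := integrable_sqr TB.
have i3 : (mu (E B x)).-integrable setT (EFin \o (fun l : borel => (l - m) ^+ 2)).
  have := integrableD measurableT (integrableB measurableT i2
    (integrableZl measurableT (2 * m) i1)) (integrable_cst (E B x) (m ^+ 2)).
  by congr (integrable _ _ _); apply/funext => l /=; congr EFin; ring.
have := @integral_concentrated_le B x (fun l => -1 * (l - m) ^+ 2) (- s ^+ 2) mB.
rewrite RintegralZl // sqnorm_op_shift // => h.
suff : -1 * \int[mu (E B x)]_l ((l - m) ^+ 2) <= - s ^+ 2 * sq (E B x) by lra.
apply: h.
  have := integrableZl measurableT (-1) i3.
  by congr (integrable _ _ _); apply/funext => l /=; rewrite EFinM.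
move=> l Bl; rewrite mulN1r lerN2 -[leRHS]real_normK ?num_real //.
by rewrite ler_sqr ?nnegrE ?Bs.
Qed.

End SpectralDecomposition.

(** * Uniqueness of the spectral measure *)

Section Uniqueness.
Context (T : @operator R V).
Local Notation borel := (measurableTypeR R).
Local Notation cc u v := (`[u, v]%classic : set (measurableTypeR R)).

Let shift (m : R) (x : V) : V := T x - m%:C *: x.

Let shift_iter (E : spectral_measure dot) (B : set borel) x (m r : R) n :
  spectral_decomposition T E -> measurable B -> 0 <= r ->
  (forall l, B l -> `|l - m| <= r) ->
  let y := iter n (shift m) (E B x) in
  [/\ E B y = y, dom T y & sq y <= (r ^+ 2) ^+ n * sq (E B x)].
Proof.
move=> TE mB r0 Br /=; elim: n => [|n [Ey Ty IH]].
  by rewrite expr0 mul1r spectral_projK //; split=> //; exact: (spectral_bounded_dom TE) Br.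
set y := iter n _ _ in Ey Ty IH *.
have [_ ED EB EZ] := linear_comb (proj_linear E mB).
have Es : E B (shift m y) = shift m y.
  by rewrite /shift EB EZ -(spectral_proj_commute TE) // Ey.
split=> //=.
- by rewrite -Es; exact: (spectral_bounded_dom TE) Br.
- have := spectral_local_bound TE y mB r0 Br; rewrite Ey => /le_trans; apply.
  by rewrite (exprS (r ^+ 2)) -mulrA ler_wpM2l ?sqr_ge0.
Qed.

(* E' decays on a vector x of the range of E [m - r, m + r] beyond any s > r:
   (T - m)^n x has norm at most r^n |x| and at least s^n |E' {|l - m| >= s} x|. *)
Let proj_far (E E' : spectral_measure dot) x (m r s : R) :
  spectral_decomposition T E -> spectral_decomposition T E' ->
  0 <= r < s -> E' (~` cc (m - s) (m + s)) (E (cc (m - r) (m + r)) x) = 0.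
Proof.
move=> TE TE' /andP[r0 rs]; set C := ~` _; set B := cc _ _.
have mB : measurable B by exact: measurable_itv.
have mC : measurable C by apply: measurableC; exact: measurable_itv.
have Br l : B l -> `|l - m| <= r.
  by rewrite /B /= in_itv /= ler_norml => /andP[? ?]; apply/andP; split; lra.
have Cs l : C l -> s <= `|l - m|.
  rewrite /C /= in_itv /= => /negP; rewrite negb_and -!ltNge => /orP[] h.
    by rewrite ler0_norm; lra.
  by rewrite ger0_norm; lra.
have s0 : 0 < s by lra.
pose y n := iter n (shift m) (E B x).
have Y n := @shift_iter E B x m r n TE mB r0 Br.
have low n : (s ^+ 2) ^+ n * sq (E' C (y 0%N)) <= sq (E' C (y n)).
  elim: n => [|n IH]; first by rewrite expr0 mul1r.
  have [_ Ty _] := Y n.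
  have [_ ED EB EZ] := linear_comb (proj_linear E' mC).
  have -> : y n.+1 = shift m (y n) by [].
  rewrite /shift EB EZ -(spectral_proj_commute TE') //.
  apply: le_trans (spectral_lower_bound TE' mC (ltW s0) Ty Cs).
  by rewrite (exprS (s ^+ 2)) -mulrA ler_wpM2l ?sqr_ge0.
apply/eqP; rewrite -sqnorm_eq0 eq_le sqnorm_ge0 andbT.
apply/ler_addgt0Pl => e e0; rewrite addr0.
have q01 : 0 <= (r / s) ^+ 2 < 1.
  rewrite sqr_ge0 /= expr_lt1 // ?divr_ge0 // ?(ltW s0) //.
  by rewrite ltr_pdivrMr // mul1r.
have [N /(_ N (leqnn _)) h] := geometric_small (sq (E B x)) q01 e0.
apply: le_trans (ltW h); have [_ _ up] := Y N.
have /(le_trans (low N)) : sq (E' C (y N)) <= (r ^+ 2) ^+ N * sq (E B x).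
  by apply: le_trans up; exact: sqnorm_proj_le.
rewrite -/(y 0%N) expr_div_n expr_div_n mulrAC ler_pdivlMr ?exprn_gt0 //.
by rewrite mulrC.
Qed.

(** [proj_far] needs a radius strictly larger than r, so the complement of the closed interval is
    exhausted by the complements of the intervals of radius r + 1/(k+1), each null for the measure
    of the projected vector under E'. *)
Let proj_itv_le (E E' : spectral_measure dot) x (m r : R) :
  spectral_decomposition T E -> spectral_decomposition T E' -> 0 <= r ->
  E' (cc (m - r) (m + r)) (E (cc (m - r) (m + r)) x) = E (cc (m - r) (m + r)) x.
Proof.
move=> TE TE' r0; set B := cc _ _; have mB : measurable B by exact: measurable_itv.
set w := E B x; apply/eqP; rewrite eq_sym -subr_eq0 -sqnorm_eq0 sqnorm_subproj //.
suff : scalar_measure E' w (~` B) = 0%E.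
  by rewrite scalar_measureE => -[->].
apply: measure_negligible; first exact: measurableC.
pose s (k : nat) : R := r + k.+1%:R^-1.
have sr k : r < s k by rewrite /s ltrDl invr_gt0.
apply: (@negligibleS _ _ _ _ (\bigcup_k ~` cc (m - s k) (m + s k))); last first.
  apply: negligible_bigcup => k; apply/negligibleP.
    by apply: measurableC; exact: measurable_itv.
  rewrite /= scalar_measureE proj_far ?sqnorm0 //.
  by rewrite r0 sr.
move=> l Bl; apply: contrapT => nl; apply: Bl.
have {}nl k : cc (m - s k) (m + s k) l.
  by apply: contrapT => h; apply: nl; exists k.
have {}nl k : `|l - m| <= s k.
  by have := nl k; rewrite /= in_itv /= ler_norml => /andP[? ?]; apply/andP; split; lra.
have : `|l - m| <= r.
  apply/ler_addgt0Pl => e e0; rewrite [e + r]addrC.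
  have h : 0 < e^-1 by rewrite invr_gt0.
  apply: le_trans (nl (Num.truncn e^-1)) _; rewrite /s lerD2l.
  by rewrite -[leRHS]invrK lef_pV2 ?posrE // ltW // truncnS_gt.
by rewrite /B /= in_itv /= ler_norml => /andP[? ?]; apply/andP; split; lra.
Qed.

(** For a closed bounded interval I, E'(I) fixes the range of E(I) and conversely; as both are
    symmetric, (E(I) x, x) = (E(I) x, E'(I) x) = (E'(I) x, x). Increasing unions extend the equality
    to the rays [u, +oo), which are stable under intersection and generate the Borel sets. *)
Lemma spectral_measure_unique (E E' : spectral_measure dot) x B :
  spectral_decomposition T E -> spectral_decomposition T E' -> measurable B ->
  scalar_measure E x B = scalar_measure E' x B.
Proof.
move=> TE TE'.
have itvE m r : 0 <= r ->
    sq (E (cc (m - r) (m + r)) x) = sq (E' (cc (m - r) (m + r)) x).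
  move=> r0; have mI : measurable (cc (m - r) (m + r)) by exact: measurable_itv.
  rewrite !sqnorm_proj //.
  rewrite -(proj_itv_le x m TE TE' r0) [LHS]rdot_proj // rdot_proj //.
  by rewrite proj_itv_le // rdotC.
move: B; apply: (@measure_unique _ R borel (@RGenCInfty.G R)
  (fun k => `[- k%:R, +oo[%classic) _ _ _ _
  (scalar_measure E x) (scalar_measure E' x)).
- exact: RGenCInfty.measurableE.
- move=> _ _ [u ->] [v ->]; exists (Num.max u v).
  by apply/seteqP; split => l /=; rewrite !in_itv /= !andbT ge_max => /andP.
- by move=> k; exists (- k%:R).
- apply/seteqP; split => // l _; exists (Num.truncn `|l|).+1 => //=.
  rewrite in_itv /= andbT; have := truncnS_gt `|l|.
  by rewrite ltr_norml => /andP[/ltW].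
- move=> _ [u ->].
  pose F (n : nat) := cc u (u + n%:R).
  have FE : `[u, +oo[%classic = \bigcup_n F n.
    apply/seteqP; split => l /=.
      rewrite in_itv /= andbT => ul; exists (Num.truncn `|l - u|).+1 => //=.
      rewrite /F /= in_itv /= ul /=; have := truncnS_gt `|l - u|.
      by rewrite ltr_norml => /andP[_]; lra.
    by case=> n _; rewrite /F /= !in_itv /= andbT => /andP[].
  have mF n : measurable (F n) by exact: measurable_itv.
  have mU : measurable (\bigcup_n F n) by exact: bigcupT_measurable.
  have ndF : {homo F : n m / (n <= m)%N >-> (n <= m)%O}.
    move=> n m nm; apply/subsetPset => l; rewrite /F /= !in_itv /= => /andP[-> h] /=.
    by apply: le_trans h _; rewrite lerD2l ler_nat.
  have c1 := nondecreasing_cvg_mu (mu := scalar_measure E x) mF mU ndF.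
  have c2 := nondecreasing_cvg_mu (mu := scalar_measure E' x) mF mU ndF.
  rewrite FE; apply: cvg_unique c1 _ => //.
  have -> : (scalar_measure E x \o F = scalar_measure E' x \o F).
    apply/funext => n /=; rewrite !scalar_measureE; congr EFin.
    have := itvE (u + n%:R / 2) (n%:R / 2); rewrite addrK -addrA.
    have -> : n%:R / 2 + n%:R / 2 = n%:R :> R by lra.
    by apply; rewrite divr_ge0.
  exact: c2.
- by move=> k; rewrite /= scalar_measureE ltry.
Qed.

End Uniqueness.

(** * Functional calculus *)

Lemma measurable_preimage (f : R -> R) (B : set (measurableTypeR R)) :
  measurable_fun (setT : set (measurableTypeR R)) (f : _ -> measurableTypeR R) ->
  measurable B -> measurable (f @^-1` B : set (measurableTypeR R)).
Proof. by move=> mf mB; rewrite -[_ @^-1` _]setTI; exact: mf. Qed.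

Section Pushforward.
Context (E : spectral_measure dot) (f : R -> R).
Local Notation borel := (measurableTypeR R).
Hypothesis mf : measurable_fun (setT : set borel) (f : borel -> borel).

Let mpre (B : set borel) (mB : measurable B) := measurable_preimage mf mB.

Let push_sigma_additive x :
  semi_sigma_additive
    (fun B : set borel => (complex.Re `|E (f @^-1` B) x| ^+ 2)%:E).
Proof.
move=> F mF tF mUF; rewrite preimage_bigcup.
apply: (measure_semi_sigma_additive (s := scalar_measure E x)).
- by move=> n; exact: mpre.
- apply/trivIsetP => /= i j _ _ ij; rewrite -preimage_setI.
  by move/trivIsetP : tF => /(_ _ _ _ _ ij) ->//; rewrite preimage_set0.
- by rewrite -preimage_bigcup; exact: mpre.
Qed.

(** With this measure, being the integral of f against E amounts to having [push_spectral] as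
    spectral decomposition, so results on decompositions transfer to functions of an operator. *)
Definition push_spectral : spectral_measure dot :=
  @SpectralMeasure _ _ dot (fun B => E (f @^-1` B))
    (fun B mB => proj_linear E (mpre mB))
    (fun B x y mB => proj_sym E x y (mpre mB))
    (fun A B x mA mB => projI E x (mpre mA) (mpre mB))
    (fun x => proj0 E x)
    (fun x => projT E x)
    push_sigma_additive.

Lemma integral_push_ge0 x (g : R -> \bar R) :
  measurable_fun setT g -> (forall l, 0 <= g l)%E ->
  (\int[scalar_measure push_spectral x]_l g l = \int[scalar_measure E x]_l g (f l))%E.
Proof.
move=> mg g0.
have := ge0_integral_pushforward mf (scalar_measure E x) measurableT mg (fun y _ => g0 y).
rewrite preimage_setT => <-; exact: eq_measure_integral.
Qed.

Lemma integral_push x (g : R -> \bar R) : measurable_fun setT g ->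
  (\int[scalar_measure push_spectral x]_l g l = \int[scalar_measure E x]_l g (f l))%E.
Proof.
move=> mg; rewrite [LHS]integralE [RHS]integralE.
rewrite (@integral_push_ge0 x g^\+%E) ?(@integral_push_ge0 x g^\-%E) //.
- by congr (_ - _)%E; apply: eq_integral => l _; rewrite ?funeposE ?funenegE.
- exact: measurable_funeneg.
- exact: measurable_funepos.
Qed.

Lemma spectral_integral_push (g : R -> R) (S : @operator R V) :
  measurable_fun (setT : set borel) (g : borel -> borel) ->
  spectral_integral push_spectral g S <-> spectral_integral E (g \o f) S.
Proof.
move=> mg.
have mg2 : measurable_fun setT (fun l => (g l ^+ 2)%:E).
  by apply/measurable_EFinP; exact: measurable_funX.
have mg1 : measurable_fun setT (fun l => (g l)%:E) by exact/measurable_EFinP.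
have dE : [set x | (\int[scalar_measure push_spectral x]_l (g l ^+ 2)%:E < +oo)%E] =
    [set x | (\int[scalar_measure E x]_l ((g \o f) l ^+ 2)%:E < +oo)%E].
  by apply/seteqP; split => x /=; rewrite (@integral_push x (fun l => (g l ^+ 2)%:E)).
have iE x : \int[scalar_measure push_spectral x]_l g l =
    \int[scalar_measure E x]_l (g \o f) l.
  by congr fine; rewrite (@integral_push x (fun l => (g l)%:E)).
by split=> -[h1 h2]; split; rewrite ?dE // -?dE // => x Sx; rewrite h2 // iE.
Qed.

End Pushforward.

Lemma spectral_integral_eq (E F : spectral_measure dot) (g : R -> R) (S : @operator R V) :
  (forall x B, measurable B -> scalar_measure E x B = scalar_measure F x B) ->
  spectral_integral E g S -> spectral_integral F g S.
Proof.
move=> EF [h1 h2].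
have iE x (k : R -> \bar R) :
    (\int[scalar_measure E x]_l k l = \int[scalar_measure F x]_l k l)%E.
  by apply: eq_measure_integral => B mB _; exact: EF.
split; first by rewrite h1; apply/seteqP; split => x /=; rewrite iE.
by move=> x Sx; rewrite h2 // /Rintegral iE.
Qed.

(** The rule g(f(H)) = (g o f)(H). The relation [function_of] hides its own spectral measure F of T;
    the image of E under f is another one, and uniqueness identifies the two. *)
Lemma function_of_integral (E : spectral_measure dot) (f g : R -> R)
    (T S : @operator R V) :
  measurable_fun (setT : set (measurableTypeR R)) (f : _ -> measurableTypeR R) ->
  measurable_fun (setT : set (measurableTypeR R)) (g : _ -> measurableTypeR R) ->
  spectral_integral E f T -> function_of dot g T S ->
  spectral_integral E (g \o f) S.
Proof.
move=> mf mg Ef [F TF Fg]; apply/(spectral_integral_push E mf S mg).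
apply: spectral_integral_eq Fg => x B mB.
apply: spectral_measure_unique TF _ mB.
by apply/(spectral_integral_push E mf T (@measurable_id _ _ _)).
Qed.

(** * Conjugation by unitaries and affiliated operators *)

Section Conjugation.
Context (E : spectral_measure dot) (u v : V -> V).
Hypotheses (lu : linear u) (lv : linear v) (uv : forall x y, dot (u x) y = dot x (v y)).
Hypotheses (uK : cancel u v) (vK : cancel v u).
Local Notation borel := (measurableTypeR R).

Let vu x y : dot (v x) y = dot x (u y).
Proof. by rewrite dotC -uv -dotC. Qed.

Let sqnorm_u x : sq (u x) = sq x.
Proof. by rewrite -!rdot_sqnorm /rdot uv uK. Qed.

Let conj_sigma_additive x :
  semi_sigma_additive (fun B : set borel => (complex.Re `|u (E B (v x))| ^+ 2)%:E).
Proof.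
have -> : (fun B : set borel => (complex.Re `|u (E B (v x))| ^+ 2)%:E) =
    (fun B => (complex.Re `|E B (v x)| ^+ 2)%:E).
  by apply/funext => B; congr EFin; exact: sqnorm_u.
exact: proj_sigma_additive.
Qed.

Let conj_linear (B : set borel) : measurable B -> linear (fun x => u (E B (v x))).
Proof.
move=> mB k x y; have [_ uD _ uZ] := linear_comb lu; have [_ vD _ vZ] := linear_comb lv.
have [_ ED _ EZ] := linear_comb (proj_linear E mB).
by rewrite vD vZ ED EZ uD uZ.
Qed.

Let conj_sym (B : set borel) x y : measurable B ->
  dot (u (E B (v x))) y = dot x (u (E B (v y))).
Proof. by move=> mB; rewrite uv proj_sym // vu. Qed.

Let conjI (A B : set borel) x : measurable A -> measurable B ->
  u (E (A `&` B) (v x)) = u (E A (v (u (E B (v x))))).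
Proof. by move=> mA mB; rewrite uK projI. Qed.

Let conj0 x : u (E set0 (v x)) = 0.
Proof. by rewrite proj0; have [] := linear_comb lu. Qed.

Let conjT x : u (E setT (v x)) = x.
Proof. by rewrite projT vK. Qed.

Definition conj_spectral : spectral_measure dot :=
  @SpectralMeasure _ _ dot (fun B x => u (E B (v x)))
    conj_linear conj_sym conjI conj0 conjT conj_sigma_additive.

Lemma conj_scalar_measure x B :
  scalar_measure conj_spectral x B = scalar_measure E (v x) B.
Proof. by congr EFin; exact: sqnorm_u. Qed.

Lemma conj_spectral_decomposition (T : @operator R V) :
  (forall x y, graph_of T (x, y) <-> graph_of T (u x, u y)) ->
  spectral_decomposition T E -> spectral_decomposition T conj_spectral.
Proof.
move=> Tu [h1 h2].
have iE x (k : R -> \bar R) :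
    (\int[scalar_measure conj_spectral x]_l k l = \int[scalar_measure E (v x)]_l k l)%E.
  by apply: eq_measure_integral => B mB _; exact: conj_scalar_measure.
have Tv x : dom T x <-> dom T (v x).
  split=> Tx.
    by have [] // := (Tu (v x) (v (T x))).2 _; rewrite !vK.
  by have [] // := (Tu (v x) (T (v x))).1 _; rewrite ?vK.
split.
  apply/seteqP; split => x /=; rewrite iE.
    by move=> /Tv; rewrite h1.
  by move=> h; apply/Tv; rewrite h1.
move=> x Tx; have Tvx := (Tv x).1 Tx.
rewrite /Rintegral iE -[X in X%:C]/(Rintegral _ _ _) -h2 //.
have [_ _] := (Tu (v x) (T (v x))).1 (And3 I Tvx erefl).
by rewrite /= vK => <-; rewrite uv.
Qed.

(** When u preserves the graph of T, the conjugate u E v is again a spectral measure of T.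
    Uniqueness yields |E B (u y)| = |E B y|, and polarization turns this into commutation. *)
Lemma conj_commute (T : @operator R V) :
  (forall x y, graph_of T (x, y) <-> graph_of T (u x, u y)) ->
  spectral_decomposition T E ->
  forall B, measurable B -> forall x, E B (u x) = u (E B x).
Proof.
move=> Tu TE B mB x; have TE' := conj_spectral_decomposition Tu TE.
have su y : sq (E B (u y)) = sq (E B y).
  have := spectral_measure_unique (u y) TE' TE mB.
  by rewrite conj_scalar_measure uK => -[].
have [_ uD uB _] := linear_comb lu.
have [_ ED EB _] := linear_comb (proj_linear E mB).
have pol a b : 4 * rdot (E B a) b = sq (E B (a + b)) - sq (E B (a - b)).
  by rewrite ED EB -rdot_parallel -rdot_proj // spectral_projK.
apply: rdot_inj => y; rewrite -(vK y).
have -> : rdot (u (E B x)) (u (v y)) = rdot (E B x) (v y).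
  by rewrite /rdot uv uK.
by apply: (@mulfI _ 4) => //; rewrite !pol -uD -uB !su.
Qed.

End Conjugation.

(** Affiliation with [commutant A] gives invariance of the graph under the unitaries of A'' = A,
    hence their commutation with E. [commute_commutant], taken at the family [commutant A], extends
    this to every element of A. *)
Lemma affiliated_spectral_commute (A : set (V -> V)) (H : @operator R V)
    (E : spectral_measure dot) :
  von_neumann_algebra dot A -> affiliated dot H (commutant A) ->
  spectral_decomposition H E ->
  forall a, A a -> forall B, measurable B -> forall x, E B (a x) = a (E B x).
Proof.
move=> [Ab Aadj AA] Haff HE a Aa B mB x.
have : a \o E B = E B \o a; last by move=> /(congr1 (@^~ x)).
apply: (@commute_commutant (commutant A)).
- exact: commutant_bounded.
- exact: proj_linear.
- by move=> a'; rewrite AA; exact: Aadj.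
- move=> u cu uu; have [[lu _] _] := cu; have [udot urange] := uu.
  have su y : exists z, u z = y.
    by have : range u y by [rewrite urange]; case=> z _ <-; exists z.
  have [v vK] := choice su.
  have uv z y : dot (u z) y = dot z (v y) by rewrite -{1}(vK y) udot.
  have uK : cancel u v.
    move=> z; apply: rdot_inj => y; rewrite rdotC [RHS]rdotC /rdot -uv.
    by rewrite udot.
  have lv : linear v.
    move=> k y z; have [_ uD _ uZ] := linear_comb lu.
    by rewrite -[RHS]uK uD uZ !vK.
  apply/funext => y /=; apply/esym.
  by apply: (conj_commute lu lv uv uK vK (Haff u cu uu) HE).
- by rewrite AA.
Qed.

Lemma spectral_integral_sqnorm (E : spectral_measure dot) (f : R -> R)
    (S : @operator R V) x :
  measurable_fun (setT : set (measurableTypeR R)) (f : _ -> measurableTypeR R) ->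
  spectral_integral E f S -> dom S x ->
  (\int[scalar_measure E x]_l (f l ^+ 2)%:E = (sq (S x))%:E)%E.
Proof.
move=> mf Ef Sx.
have Sf : spectral_decomposition S (push_spectral E mf).
  exact/(spectral_integral_push E mf S (@measurable_id _ _ _)).
rewrite -(spectral_second_moment Sf Sx).
rewrite (integral_push E mf x (g := fun l => (l ^+ 2)%:E)) //.
by apply/measurable_EFinP; exact: exprn_measurable.
Qed.

Lemma spectral_integral_commute (E : spectral_measure dot) (f : R -> R)
    (S : @operator R V) (a b : V -> V) x :
  measurable_fun (setT : set (measurableTypeR R)) (f : _ -> measurableTypeR R) ->
  spectral_integral E f S -> linear a -> linear b ->
  (forall x y, rdot (a x) y = rdot x (b y)) ->
  (forall B, measurable B -> forall x, E B (a x) = a (E B x)) ->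
  dom S x -> dom S (a x) /\ S (a x) = a (S x).
Proof.
move=> mf Ef la lb ab aE.
have Sf : spectral_decomposition S (push_spectral E mf).
  exact/(spectral_integral_push E mf S (@measurable_id _ _ _)).
apply: (spectral_commute Sf la lb ab) => B mB y /=.
by apply: aE; exact: (measurable_preimage mf mB).
Qed.

(** * Positive operators *)

Section Positive.
Context (E : spectral_measure dot) (S : @operator R V).
Hypothesis SE : spectral_decomposition S E.
Hypothesis E_pos : forall x, E `]-oo, 0]%classic x = 0.

(** Bounded and bounded away from 0, so that S is bounded above and below on the range of the
    projection. The bands exhaust ]0, +oo[, which carries all the mass by [E_pos]. *)
Let band (n : nat) : set (measurableTypeR R) := `[n.+1%:R^-1, n.+1%:R]%classic.

Let measurable_band n : measurable (band n).
Proof. exact: measurable_itv. Qed.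

Let band_approx x (e : R) : 0 < e -> exists n, sq (x - E (band n) x) < e.
Proof.
move=> e0; pose mu := scalar_measure E x.
have mU : measurable (\bigcup_n band n) by exact: bigcupT_measurable.
have ndF : {homo band : n m / (n <= m)%N >-> (n <= m)%O}.
  move=> n m nm; apply/subsetPset => l; rewrite /band /= !in_itv /= => /andP[h1 h2].
  have nm' : n.+1%:R <= m.+1%:R :> R by rewrite ler_nat.
  apply/andP; split; last exact: le_trans nm'.
  by apply: le_trans h1; rewrite lef_pV2 ?posrE.
have UE : \bigcup_n band n = `]0, +oo[%classic.
  apply/seteqP; split => l /=.
    case=> n _; rewrite /band /= !in_itv /= andbT => /andP[+ _].
    by apply: lt_le_trans; rewrite invr_gt0.
  rewrite in_itv /= andbT => l0.
  exists (maxn (Num.truncn l) (Num.truncn l^-1)) => //.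
  rewrite /band /= in_itv /=; apply/andP; split.
    rewrite -[leRHS]invrK lef_pV2 ?posrE ?invr_gt0 //.
    apply/ltW/(lt_le_trans (truncnS_gt _)).
    by rewrite ler_nat ltnS leq_maxr.
  apply/ltW/(lt_le_trans (truncnS_gt _)).
  by rewrite ler_nat ltnS leq_maxl.
have sU : sq (E (\bigcup_n band n) x) = sq x.
  pose N : set (measurableTypeR R) := `]-oo, 0]%classic.
  have mN : measurable N by exact: measurable_itv.
  have -> : sq x = sq (E N x) + sq (E (~` N) x) by exact: (sqnorm_projC E x mN).
  by rewrite UE /N E_pos sqnorm0 add0r setCitvl.
have := nondecreasing_cvg_mu (mu := mu) measurable_band mU ndF.
rewrite /= scalar_measureE sU.
move=> /fine_cvgP[_ /cvgrPdist_lt/(_ _ e0)[N _ /(_ N (leqnn _))]].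
rewrite /= -/(sq _) => h; exists N; rewrite sqnorm_subproj //.
move: h; rewrite (sqnorm_projC E x (measurable_band N)) addrC addKr.
by apply: le_lt_trans; exact: ler_norm.
Qed.

(** S commutes with the projection on a band and is bounded below there by 1/(n+1), so S x = 0 kills
    every E (band n) x, and these vectors approximate x. *)
Lemma positive_inj x : dom S x -> S x = 0 -> x = 0.
Proof.
move=> Sx Sx0; apply/eqP; rewrite -sqnorm_eq0 eq_le sqnorm_ge0 andbT.
apply/ler_addgt0Pl => e e0; rewrite addr0.
have [n h] := band_approx x e0; apply: ltW; apply: le_lt_trans h.
suff -> : E (band n) x = 0 by rewrite subr0.
have s0 : 0 < n.+1%:R^-1 :> R by rewrite invr_gt0.
have := spectral_lower_bound (m := 0) SE (measurable_band n) (ltW s0) Sx.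
rewrite scale0r subr0 (spectral_proj_commute SE) // Sx0.
have [-> _ _ _] := linear_comb (proj_linear E (measurable_band n)).
rewrite sqnorm0 => h; apply/eqP; rewrite -sqnorm_eq0 eq_le sqnorm_ge0 andbT.
rewrite -(pmulr_rle0 _ (exprn_gt0 2 s0)); apply: h => l.
rewrite /band /= in_itv /= subr0 => /andP[h _]; exact: le_trans (ler_norm _).
Qed.

(* On a band [a, b] with 0 < a and midpoint m, 1 - S / m is a contraction,
   and w - (1 - S / m)^k w lies in the range of S. *)
Lemma positive_range_dense y (e : R) : 0 < e -> exists2 x, dom S x & sq (y - S x) < e.
Proof.
move=> e0; have e4 : 0 < e / 4 by lra.
have [n hn] := band_approx y e4; pose B := band n.
have mB : measurable B := measurable_band n.
pose a : R := n.+1%:R^-1; pose b : R := n.+1%:R.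
have a0 : 0 < a by rewrite invr_gt0.
have ab : a <= b.
  by apply: (@le_trans _ _ 1); [rewrite invf_le1 // ler1n|rewrite ler1n].
pose m := (a + b) / 2; pose r := (b - a) / 2.
have m0 : 0 < m by rewrite /m; lra.
have r0 : 0 <= r by rewrite /r; lra.
have Br l : B l -> `|l - m| <= r.
  rewrite /B /band /= in_itv /= -/a -/b ler_norml /m /r => /andP[? ?].
  by apply/andP; split; lra.
have q01 : 0 <= (r / m) ^+ 2 < 1.
  rewrite sqr_ge0 /= expr_lt1 //; last exact: divr_ge0 r0 (ltW m0).
  by rewrite ltr_pdivrMr // mul1r /r /m; lra.
have [_ ED EB EZ] := linear_comb (proj_linear E mB).
(* Here w = (1 - S/m)^k E B y, and x is the k-th partial sum of the Neumann series for the inverse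
   of S applied to E B y. The ratio r/m is below 1 because a > 0. *)
have step k : exists w x, [/\ E B w = w, dom S x, E B y - w = S x &
    sq w <= ((r / m) ^+ 2) ^+ k * sq (E B y)].
  elim: k => [|k [w [x [Ew Sx wx hw]]]].
    exists (E B y), 0; split; [exact: spectral_projK|exact: dom0| |].
      by rewrite subrr op0.
    by rewrite expr0 mul1r.
  have Sw : dom S w by rewrite -Ew; exact: (spectral_bounded_dom SE) Br.
  exists (w - (m^-1)%:C *: S w), (x + (m^-1)%:C *: w); split.
  - by rewrite EB EZ -(spectral_proj_commute SE) // Ew.
  - by apply: domD => //; exact: domZ.
  - by rewrite opD ?opZ //; [rewrite opprB addrA addrAC wx|exact: domZ].
  - have -> : w - (m^-1)%:C *: S w = (- m^-1)%:C *: (S w - m%:C *: w).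
      rewrite scalerBr scalerA -rmorphM /= mulNr mulVf ?gt_eqF //.
      by rewrite !rmorphN /= rmorph1 !scaleNr scale1r opprK addrC.
    rewrite sqnormZ sqrrN exprVn.
    have := spectral_local_bound SE w mB r0 Br; rewrite Ew => h.
    rewrite (exprS ((r / m) ^+ 2)) -mulrA.
    have m2 : 0 <= m^-2 by rewrite invr_ge0 sqr_ge0.
    apply: le_trans (ler_wpM2l m2 h) _.
    have -> : m^-2 * (r ^+ 2 * sq w) = (r / m) ^+ 2 * sq w.
      by field; rewrite gt_eqF.
    by rewrite ler_wpM2l ?sqr_ge0.
have [k /(_ k (leqnn _)) hk] := geometric_small (sq (E B y)) q01 e4.
have [w [x [Ew Sx wx hw]]] := step k; exists x => //.
have -> : y - S x = (y - E B y) + w by rewrite -wx opprB addrA addrAC.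
apply: le_lt_trans (sqnormD_le _ _) _.
have := le_lt_trans hw hk; move: hn; rewrite -/B; lra.
Qed.

End Positive.

(** * Comparison of functions of an operator *)

Lemma vn_comp (A : set (V -> V)) a b :
  von_neumann_algebra dot A -> A a -> A b -> A (a \o b).
Proof. by move=> [_ _ AA]; rewrite -AA; exact: commutant_comp. Qed.

(** If a Omega = 0, then with b the adjoint of a, omega (b a) = |a Omega|^2 = 0. Faithfulness gives
    b a = 0, and (b a x, x) = |a x|^2 then gives a = 0. *)
Lemma cyclic_faithful_separating (A : set (V -> V)) (omega : (V -> V) -> R[i]) Omega :
  von_neumann_algebra dot A -> faithful_on dot A omega ->
  gns_vector dot A omega Omega -> separating_vector A Omega.
Proof.
move=> vnA faith [omegaE _] a Aa aO; have [Ab Aadj _] := vnA.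
have [b Ab' ab] := Aadj _ Aa.
have [b0 _ _ _] : [/\ b 0 = 0, _, _ & _] := linear_comb (Ab _ Ab').1.
have baE x : dot (b (a x)) x = (sq (a x))%:C.
  by rewrite dotC -ab dot_sqnorm; exact: conjc_real.
have ba0 : b \o a = (fun=> 0).
  apply: faith; first exact: vn_comp.
    by move=> x /=; rewrite linear0l baE lecR sqnorm_ge0.
  by rewrite omegaE /= ?aO ?b0 ?linear0l //; exact: vn_comp.
apply/funext => x; apply/eqP; rewrite -sqnorm_eq0.
have := baE x; rewrite -[b (a x)]/((b \o a) x) ba0 linear0l => /esym/eqP.
by rewrite -(rmorph0 (real_complex R)) (inj_eq (@complexI R)).
Qed.

Section Core.
Context (G : spectral_measure dot) (f g : R -> R) (H S T : @operator R V).
Local Notation borel := (measurableTypeR R).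
Hypotheses (mf : measurable_fun (setT : set borel) (f : borel -> borel))
  (mg : measurable_fun (setT : set borel) (g : borel -> borel)).
Hypotheses (HG : spectral_decomposition H G) (Sf : spectral_integral G f S)
  (Tg : spectral_integral G g T).
Hypothesis gf : forall l, g l ^+ 2 <= 1 + f l ^+ 2.

Let mf2 : measurable_fun setT (fun l : borel => (f l ^+ 2)%:E).
Proof. by apply/measurable_EFinP; exact: measurable_funX. Qed.
Let mg2 : measurable_fun setT (fun l : borel => (g l ^+ 2)%:E).
Proof. by apply/measurable_EFinP; exact: measurable_funX. Qed.

Let integral_le x : (\int[scalar_measure G x]_l (g l ^+ 2)%:E <=
  (sq x)%:E + \int[scalar_measure G x]_l (f l ^+ 2)%:E)%E.
Proof.
have e : (\int[scalar_measure G x]_l (cst 1%:E l) = (sq x)%:E)%E.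
  by rewrite integral_cst //= mul1e scalar_measureT.
rewrite -e -ge0_integralD //; last by move=> l _; rewrite lee_fin sqr_ge0.
apply: ge0_le_integral => //.
- by move=> l _; rewrite lee_fin sqr_ge0.
- by apply: emeasurable_funD.
- by move=> l _; rewrite /= -EFinD lee_fin.
Qed.

Lemma dominated_dom : dom S `<=` dom T.
Proof.
move=> x Sx; rewrite Tg.1 /=; apply: le_lt_trans (integral_le x) _.
by rewrite (spectral_integral_sqnorm mf Sf Sx) -EFinD ltry.
Qed.

Lemma dominated_sqnorm x : dom S x -> sq (T x) <= sq x + sq (S x).
Proof.
move=> Sx; have := integral_le x.
rewrite (spectral_integral_sqnorm mf Sf Sx).
by rewrite (spectral_integral_sqnorm mg Tg (dominated_dom Sx)) -EFinD lee_fin.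
Qed.

Lemma spectral_integral_closed : closure (graph_of T) = graph_of T.
Proof.
apply: (@spectral_closed (push_spectral G mg)).
exact/(spectral_integral_push G mg T (@measurable_id _ _ _)).
Qed.

(* E [-n, n) psi lies in the domain of H, hence of S, and approximates psi in the graph
   norm of T; there the graph norm of S controls that of T. *)
Lemma dominated_core (D : set V) : dom H `<=` dom S -> core_of D S -> core_of D T.
Proof.
move=> HS [DS coreS]; split; first by move=> x /DS; exact: dominated_dom.
apply/seteqP; split.
  rewrite -spectral_integral_closed; apply: closure_subset.
  by move=> p [_ Tp ep]; split.
move=> [x y] [/= _ Tx ->{y}]; apply/closure_sqnormP => e e0 /=.
have e4 : 0 < e / 4 by lra.
have [N1 h1] := trunc_approx G x e4.
have [N2 h2] := trunc_approx G (T x) e4.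
pose n := maxn N1 N2; pose P := G (trunc n).
have mn : measurable (trunc n : set borel) by exact: measurable_trunc.
have [TP PT] : dom T (P x) /\ T (P x) = P (T x).
  apply: (spectral_integral_commute mg Tg (proj_linear G mn) (proj_linear G mn)) => //.
    by move=> u v; exact: rdot_proj.
  by move=> B mB z; rewrite -!projI // setIC.
have SP : dom S (P x) by apply: HS; exact: (trunc_dom HG).
have : closure (restricted_graph D S) (P x, S (P x)) by rewrite coreS.
(* The graph distance for S enters twice in the bound on T (P x - z), through |P x - z|^2 and |S (P
   x - z)|^2: 2 (e/4) + 2 (e/8 + e/8) = e. *)
have e8 : 0 < e / 8 by lra.
move=> /closure_sqnormP/(_ _ e8)[[z w] [[/= Dz Sz ->{w}] hz hSz]].
exists (z, T z); split => /=.
- by split=> //; exact: dominated_dom.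
- have -> : x - z = (x - P x) + (P x - z) by rewrite addrA subrK.
  apply: le_lt_trans (sqnormD_le _ _) _.
  have := h1 n (leq_maxl _ _); rewrite -/P; lra.
- have -> : T x - T z = (T x - P (T x)) + T (P x - z).
    by rewrite opB ?PT ?addrA ?subrK //; exact: dominated_dom.
  apply: le_lt_trans (sqnormD_le _ _) _.
  have := h2 n (leq_maxr _ _); rewrite -/P.
  have := dominated_sqnorm (domB SP Sz); rewrite (opB SP Sz); lra.
Qed.

End Core.

Lemma spectral_integral_subC (E : spectral_measure dot) (T : @operator R V) (c : R) :
  spectral_decomposition T E -> spectral_integral E (fun l => l - c) (op_subC T c%:C).
Proof.
move=> TE.
(* The shift keeps the domain, so l^2 and (l - c)^2 must be integrable together; this comparison
   serves both directions, the gaps in the pointwise bounds being (l + c)^2 and (l - 2 c)^2. *)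
have lt_fin x (f g : R -> R) :
    measurable_fun (setT : set (measurableTypeR R)) (f : _ -> measurableTypeR R) ->
    measurable_fun (setT : set (measurableTypeR R)) (g : _ -> measurableTypeR R) ->
    (forall l, g l ^+ 2 <= 2 * c ^+ 2 + 2 * f l ^+ 2) ->
    (\int[scalar_measure E x]_l (f l ^+ 2)%:E < +oo ->
     \int[scalar_measure E x]_l (g l ^+ 2)%:E < +oo)%E.
  move=> mf mg gf ffin.
  have mf2 : measurable_fun setT (fun l : measurableTypeR R => (f l ^+ 2)%:E).
    by apply/measurable_EFinP; exact: measurable_funX.
  have mg2 : measurable_fun setT (fun l : measurableTypeR R => (g l ^+ 2)%:E).
    by apply/measurable_EFinP; exact: measurable_funX.
  apply: (@le_lt_trans _ _ (\int[scalar_measure E x]_l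
      (cst (2 * c ^+ 2)%R%:E l + 2%:E * (f l ^+ 2)%:E))%E).
    apply: ge0_le_integral => //.
    - by move=> l _; rewrite lee_fin sqr_ge0.
    - by apply: emeasurable_funD => //; exact: measurable_funeM.
    - by move=> l _; rewrite /= -EFinM -EFinD lee_fin.
  rewrite ge0_integralD //; last 3 first.
  - by move=> l _; rewrite lee_fin mulr_ge0 ?sqr_ge0.
  - by move=> l _; rewrite -EFinM lee_fin mulr_ge0 ?sqr_ge0.
  - exact: measurable_funeM.
  rewrite ge0_integralZl //; last by move=> l _; rewrite lee_fin sqr_ge0.
  apply: lte_add_pinfty; last exact: lte_mul_pinfty.
  by rewrite integral_cst //= -EFinM ltry.
have mid : measurable_fun (setT : set (measurableTypeR R)) (id : _ -> measurableTypeR R).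
  exact: measurable_id.
have msub : measurable_fun (setT : set (measurableTypeR R))
    ((fun l => l - c) : _ -> measurableTypeR R).
  by apply: measurable_funB => //; exact: measurable_cst.
split.
  apply/seteqP; split => x /=; rewrite (spectral_domE TE).
    by apply: lt_fin => // l; have := sqr_ge0 (l + c); nra.
  by apply: (lt_fin x (fun l => l - c) id) => // l; have := sqr_ge0 (l - 2 * c); nra.
move=> x Tx; have {}Tx : dom T x by [].
rewrite /= linearBl linearZl_LR /= dot_sqnorm TE.2 // -rmorphM -rmorphB /=.
congr (_%:C); rewrite RintegralB //; last 2 first.
- exact: (integrable_id TE Tx).
- exact: integrable_cst.
by rewrite Rintegral_cst // /= projT.
Qed.

End HilbertSpaceTheory.

Theorem proposition3p5 (R : realType) (V : completeNormedModType R[i])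
  (dot : {dot V for Num.conj}) (norm_dot : forall x : V, `|x| ^+ 2 = dot x x)
  (A : set (V -> V)) (vnA : von_neumann_algebra dot A)
  (omega : (V -> V) -> R[i]) (omega_state : state_on dot A omega)
  (omega_faithful : faithful_on dot A omega)
  (omega_normal : normal_on dot A omega)
  (Omega : V) (Omega_unit : `|Omega| = 1)
  (Omega_gns : gns_vector dot A omega Omega)
  (H : @operator R V) (H_sa : self_adjoint dot H)
  (H_aff : affiliated dot H (commutant A))
  (sqrtAbsH : @operator R V) (sqrtAbsHP : sqrt_abs_of dot H sqrtAbsH)
  (Omega_dom : dom sqrtAbsH Omega) (H_mean : mean_is dot H Omega 0)
  (alpha : R) (alphaP : is_alpha dot H Omega alpha)
  (X : @operator R V) (XP : exp_phi_of dot H alpha X)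
  (sqrtX : @operator R V) (sqrtXP : function_of dot Num.sqrt X sqrtX) :
  [/\ dom sqrtAbsH `<=` dom sqrtX,
      forall psi, dom sqrtAbsH psi ->
        `|sqrtX psi| ^+ 2 <= `|psi| ^+ 2 + `|sqrtAbsH psi| ^+ 2,
      separating_vector A (sqrtX Omega),
      core_of (orbit_of A Omega) sqrtAbsH -> core_of (orbit_of A Omega) sqrtX
    & core_of (orbit_of A Omega) sqrtX -> cyclic_vector A (sqrtX Omega)].
Proof.
have [_ A_adj _] := vnA.
have [absH [G HG Gabs] absS] := sqrtAbsHP.
have msqrt : measurable_fun (setT : set (measurableTypeR R))
    (Num.sqrt : _ -> measurableTypeR R).
  by apply: nondecreasing_measurable => // x y; exact: ler_wsqrtr.
have mnorm : measurable_fun (setT : set (measurableTypeR R))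
    (Num.norm : R -> measurableTypeR R) by exact: normr_measurable.
have mexp : measurable_fun (setT : set (measurableTypeR R))
    (exp_phi : R -> measurableTypeR R).
  by apply: nondecreasing_measurable => //; exact: exp_phi_nondecreasing.
have mshift : measurable_fun (setT : set (measurableTypeR R))
    ((fun l => l - alpha) : R -> measurableTypeR R).
  by apply: measurable_funB; [exact: measurable_id|exact: measurable_cst].
have mid : measurable_fun (setT : set (measurableTypeR R)) (id : _ -> measurableTypeR R).
  exact: measurable_id.
pose f := Num.sqrt \o Num.norm : R -> R.
pose g := Num.sqrt \o (exp_phi \o (fun l => l - alpha)) : R -> R.
have mf : measurable_fun (setT : set (measurableTypeR R)) (f : _ -> measurableTypeR R).
  exact: measurableT_comp.
have mexps : measurable_fun (setT : set (measurableTypeR R))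
    ((exp_phi \o (fun l => l - alpha)) : _ -> measurableTypeR R).
  exact: measurableT_comp.
have mg : measurable_fun (setT : set (measurableTypeR R)) (g : _ -> measurableTypeR R).
  exact: measurableT_comp.
have KG : spectral_integral G f sqrtAbsH.
  exact: (function_of_integral norm_dot mnorm msqrt Gabs absS).
have XG : spectral_integral G (exp_phi \o (fun l => l - alpha)) X.
  apply: (function_of_integral norm_dot mshift mexp _ XP).
  exact: spectral_integral_subC.
have SG : spectral_integral G g sqrtX.
  exact: (function_of_integral norm_dot mexps msqrt XG sqrtXP).
have alpha0 : 0 <= alpha by case: alphaP.
have f2 l : f l ^+ 2 = `|l| by rewrite /f /= sqr_sqrtr.
have gf l : g l ^+ 2 <= 1 + f l ^+ 2.
  rewrite f2 /g /= sqr_sqrtr; last exact/ltW/exp_phi_gt0.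
  (* Here [alpha0] enters: l - alpha <= l because alpha is non-negative. *)
  apply: le_trans (exp_phi_le l); apply: exp_phi_nondecreasing.
  by rewrite gerBl.
(* The domination argument with the identity in the role of f: |l| <= 1 + l^2 places the domain of H
   inside that of |H|^(1/2), which [dominated_core] requires. *)
have fid l : f l ^+ 2 <= 1 + (id l) ^+ 2.
  rewrite f2 -real_normK ?num_real //; have := normr_ge0 l; nra.
have HK : dom H `<=` dom sqrtAbsH by exact: (dominated_dom norm_dot mid mf HG KG fid).
have KS : dom sqrtAbsH `<=` dom sqrtX by exact: (dominated_dom norm_dot mf mg KG SG gf).
have Omega_S : dom sqrtX Omega by exact: KS.
have commA a : A a -> linear a /\ forall x, dom sqrtX x ->
    dom sqrtX (a x) /\ sqrtX (a x) = a (sqrtX x).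
  move=> Aa; have [Ab _ _] := vnA; have [la _] := Ab _ Aa; split => // x Sx.
  have [b Ab' ab] := A_adj _ Aa; have [lb _] := Ab _ Ab'.
  apply: (spectral_integral_commute norm_dot mg SG la lb) => //.
    by move=> u v; rewrite /rdot ab.
  by move=> B mB u; apply: (affiliated_spectral_commute norm_dot vnA H_aff HG).
have SE : spectral_decomposition sqrtX (push_spectral G mg).
  exact/(spectral_integral_push G mg sqrtX mid).
have posE x : push_spectral G mg `]-oo, 0]%classic x = 0.
  rewrite /= (_ : g @^-1` _ = set0) ?proj0 //.
  apply/seteqP; split => l //=; rewrite in_itv /= leNgt sqrtr_gt0.
  by rewrite exp_phi_gt0.
split=> //.
- move=> psi Kpsi; rewrite -!sqnormE -rmorphD lecR.
  exact: (dominated_sqnorm norm_dot mf mg KG SG gf).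
- move=> a Aa aS0; have [la Sa] := commA _ Aa; have [SaO SaE] := Sa _ Omega_S.
  (* Since Omega is separating, it is enough to prove a Omega = 0; injectivity of X^(1/2) reduces
     this to X^(1/2) a Omega = 0. *)
  apply: (cyclic_faithful_separating norm_dot vnA omega_faithful Omega_gns Aa).
  by apply: (positive_inj norm_dot SE posE SaO); rewrite SaE.
- exact: (dominated_core norm_dot mf mg HG KG SG gf).
- move=> [DS coreS]; apply/dense_sqnormP => y e e0.
  have e4 : 0 < e / 4 by lra.
  have [x Sx yx] := positive_range_dense norm_dot SE posE y e4.
  (* The core property replaces the arbitrary X^(1/2) x by X^(1/2) a Omega = a X^(1/2) Omega; the
     two errors of size e/4 add up to less than e in squared norm. *)
  have : closure (restricted_graph (orbit_of A Omega) sqrtX) (x, sqrtX x).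
    by rewrite coreS.
  move=> /closure_sqnormP/(_ _ e4)[[z w] [[/= [a Aa <-] _ ->] _ hw]].
  have [la Sa] := commA _ Aa; have [_ SaE] := Sa _ Omega_S.
  exists (a (sqrtX Omega)); first by exists a.
  have -> : y - a (sqrtX Omega) = (y - sqrtX x) + (sqrtX x - sqrtX (a Omega)).
    by rewrite SaE addrA subrK.
  apply: le_lt_trans (sqnormD_le norm_dot _ _) _; lra.
Qed.
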